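(* Let $\mathcal A$ be a family of connected planar graphs, let $A_n$ be the number of graphs in $\mathcal A$ with $n$ labelled vertices, and let $A(x)=\sum_n A_n x^n/n!$. Assume that the radius of convergence of $A(x)$ is strictly larger than $\rho=\gamma^{-1}$. Let $X_n$ denote the number of connected components that belong to $\mathcal A$ in a random planar graph with $n$ vertices. Then, as $n\to\infty$, $X_n$ is distributed asymptotically as a Poisson law of parameter $A(\rho)$.
   Context: All graphs are labelled; a random planar graph with $n$ vertices is uniform among all labelled planar graphs on $\{1,\dots,n\}$. The family $\mathcal A$ is a class of labelled graphs closed under relabelling of vertices (isomorphism), so that it makes sense for a component to belong to $\mathcal A$. If $g_n$ is the number of labelled planar graphs on $n$ vertices, then $\gamma=\lim_{n\to\infty}(g_n/n!)^{1/n}\approx 27.2268777685$; $\rho=\gamma^{-1}$ is the radius of convergence of the exponential generating function $C(x)=\sum c_nx^n/n!$ of labelled connected planar graphs. ''Distributed asymptotically as a Poisson law'' means convergence in distribution to that law. *)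

(* Defs.v *)
From HB Require Import structures.
From mathcomp Require Import all_boot all_order all_algebra.
From mathcomp Require Import all_classical all_reals all_analysis.

Set Implicit Arguments.
Unset Strict Implicit.
Unset Printing Implicit Defensive.

Import Order.TTheory GRing.Theory Num.Theory.
Import numFieldNormedType.Exports.

Local Open Scope classical_set_scope.
Local Open Scope ring_scope.

Record sgraph (V : finType) := SGraph {
  edges : {set {set V}};
  edges_card2 : [forall e in edges, #|e| == 2%N]
}.

HB.instance Definition _ (V : finType) := [isSub for @edges V].
HB.instance Definition _ (V : finType) := [Finite of sgraph V by <:].

Section Graphs.
Variables (V : finType) (G : sgraph V).

Definition adj : rel V := fun x y => [set x; y]%SET \in edges G.

(* The graph on the empty vertex set is not connected. *)
Definition connected_graph : bool :=
  (0 < #|V|)%N && [forall x, forall y, connect adj x y].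

Definition components : {set {set V}} :=
  equivalence_partition (connect adj) [set: V]%SET.

Section Induced.
Variable S : {set V}.

Definition induced_edges : {set {set {x : V | x \in S}}} :=
  [set e : {set {x : V | x \in S}} | (val @: e)%SET \in edges G]%SET.

Fact induced_edges_card2 : [forall e in induced_edges, #|e| == 2%N].
Proof.
apply/forall_inP => e; rewrite finset.inE => he.
by rewrite -(card_imset _ val_inj) (forall_inP (edges_card2 G)).
Qed.

Definition induced : sgraph {x : V | x \in S} := SGraph induced_edges_card2.
End Induced.
End Graphs.

Fact edgeless_card2 (V : finType) :
  [forall e in (finset.set0 : {set {set V}}), #|e| == 2%N].
Proof. by apply/forall_inP => e; rewrite finset.inE. Qed.

Definition edgeless (V : finType) : sgraph V := SGraph (edgeless_card2 V).

Definition isomorphic (V W : finType) (G : sgraph V) (H : sgraph W) : Prop :=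
  exists2 f : V -> W, bijective f & forall x y, adj H (f x) (f y) = adj G x y.

(* A class lives on arbitrary finite label sets, so that membership makes sense
   for a component, whose label set is only a subset of {0, ..., n-1}. *)
Definition graph_class := forall V : finType, sgraph V -> Prop.

Definition iso_closed (A : graph_class) : Prop :=
  forall (V W : finType) (G : sgraph V) (H : sgraph W),
    isomorphic G H -> A V G -> A W H.

(* G can be drawn in the plane without crossings, edges being Jordan arcs;
   [arc e] only matters for edges e and parameters in [0, 1]. *)
Definition planar (R : realType) (V : finType) (G : sgraph V) : Prop :=
  exists (p : V -> R * R) (arc : {set V} -> R -> R * R),
  [/\ injective p,
      forall e, e \in edges G ->
        [/\ {within `[0, 1], continuous (arc e)},
            {in `[0, 1] &, injective (arc e)} &
            exists u v, [/\ e = [set u; v]%SET, arc e 0 = p u & arc e 1 = p v]],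
      forall e (t : R) v, e \in edges G -> t \in `]0, 1[ -> arc e t <> p v &
      forall e e' (s t : R), e \in edges G -> e' \in edges G -> e != e' ->
        s \in `]0, 1[ -> t \in `]0, 1[ -> arc e s <> arc e' t].

Fact edgeless_planar (R : realType) n : planar R (edgeless 'I_n).
Proof.
exists (fun i : 'I_n => ((i : nat)%:R, 0)), (fun _ _ => (0, 0)); split.
- by move=> i j [] /eqP; rewrite eqr_nat => /eqP /val_inj.
- by move=> e; rewrite finset.inE.
- by move=> e t v; rewrite finset.inE.
- by move=> e e' s t; rewrite finset.inE.
Qed.

Definition class_graphs (A : graph_class) (n : nat) : {set sgraph 'I_n} :=
  [set G : sgraph 'I_n | `[< A 'I_n G >]]%SET.

Definition egf_coef (R : realType) (A : graph_class) (n : nat) : R :=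
  #|class_graphs A n|%:R / n`!%:R.

Definition egf (R : realType) (A : graph_class) (x : R) : R :=
  limn (pseries (egf_coef R A) x).

(* Only real points are tested; this gives the same radius as complex ones. *)
Definition convergence_radius (R : realType) (a : nat -> R) : \bar R :=
  ereal_sup [set `|x|%:E | x in [set x : R | cvgn (pseries a x)]].

(* [limn] is a total operator, whose value is the limit when there is one. *)
Definition planar_growth (R : realType) : R :=
  limn (fun n => egf_coef R (@planar R) n `^ (n%:R)^-1).

Definition planar_rho (R : realType) : R := (planar_growth R)^-1.

HB.instance Definition _ (V : finType) := isPointed.Build (sgraph V) (edgeless V).
HB.instance Definition _ (V : finType) :=
  @isMeasurable.Build default_measure_display (sgraph V) discrete_measurable
    discrete_measurable0 discrete_measurableC discrete_measurableU.

(* The law of a uniform planar graph, carried by the space of all labelled graphs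
   with the discrete sigma-algebra. *)
Definition random_planar (R : realType) (n : nat) (U : set (sgraph 'I_n)) : \bar R :=
  (#|[set G in class_graphs (@planar R) n | G \in U]%SET|%:R
     / #|class_graphs (@planar R) n|%:R)%:E.
Arguments random_planar R n U : clear implicits.

Section RandomPlanar.
Variables (R : realType) (n : nat).
Local Notation PG := (class_graphs (@planar R) n).
Local Notation P := (@random_planar R n).

Let PG_gt0 : (0 < #|PG|)%N.
Proof.
by apply/card_gt0P; exists (edgeless 'I_n); rewrite finset.inE;
   apply/asboolP/edgeless_planar.
Qed.

Let dirac_PG (k : nat) : {measure set (sgraph 'I_n) -> \bar R} :=
  dirac (nth (edgeless 'I_n) (enum PG) k).

Let invPG_ge0 : 0 <= (#|PG|%:R : R)^-1. Proof. by rewrite invr_ge0. Qed.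

Let PE : P = mscale (NngNum invPG_ge0) (msum dirac_PG #|PG|).
Proof.
apply/funext => U; rewrite /random_planar /mscale /=.
rewrite mulrC EFinM; congr (_ * _)%E.
rewrite /msum; under eq_bigr do rewrite /dirac_PG /= diracE.
rewrite sumEFin; congr (_%:E).
rewrite -natr_sum; congr (_%:R).
rewrite (cardE PG) -(big_mkord predT
  (fun k => nat_of_bool (nth (edgeless 'I_n) (enum PG) k \in U))).
rewrite -(big_nth _ predT (fun G => nat_of_bool (G \in U))).
rewrite big_enum /= -big_mkcondr /= sum1_card.
by apply: eq_card => G; rewrite finset.inE.
Qed.

Let P0 : P set0 = 0%E. Proof. by rewrite PE measure0. Qed.
Let P_ge0 U : (0 <= P U)%E. Proof. by rewrite PE. Qed.
Let P_sigma_additive : semi_sigma_additive P.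
Proof. by rewrite PE; exact: measure_semi_sigma_additive. Qed.

HB.instance Definition _ := isMeasure.Build _ _ _ P P0 P_ge0 P_sigma_additive.

Let PT : P setT = 1%E.
Proof.
rewrite /random_planar (_ : [set G in PG | _]%SET = PG) ?divff //.
  by rewrite pnatr_eq0 -lt0n.
by apply/setP => G; rewrite finset.inE in_setT andbT.
Qed.

HB.instance Definition _ := Measure_isProbability.Build _ _ R P PT.

End RandomPlanar.

Definition components_in (R : realType) (A : graph_class) (n : nat)
    (G : sgraph 'I_n) : R :=
  #|[set S in components G | `[< A _ (induced G S) >]]%SET|%:R.
Arguments components_in R A n G : clear implicits.

Fact components_in_measurable (R : realType) (A : graph_class) (n : nat) :
  measurable_fun setT (@components_in R A n).
Proof. by []. Qed.

HB.instance Definition _ (R : realType) (A : graph_class) (n : nat) :=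
  isMeasurableFun.Build _ _ _ _ (@components_in R A n)
    (@components_in_measurable R A n).

(* [poisson_prob] is a measure on nat; its last argument is a dummy. *)
Definition poisson (R : realType) (rate : R) : probability nat R :=
  poisson_prob rate 0.

Definition natR (R : realType) (k : nat) : R := k%:R.

Fact natR_measurable (R : realType) : measurable_fun setT (@natR R).
Proof. by []. Qed.

HB.instance Definition _ (R : realType) :=
  isMeasurableFun.Build _ _ _ _ (@natR R) (@natR_measurable R).

Definition cvg_in_distribution (R : realType)
    (d : nat -> measure_display) (T : forall n, measurableType (d n))
    (P : forall n, probability (T n) R) (X : forall n, {RV (P n) >-> R})
    (d' : measure_display) (T' : measurableType d') (Q : probability T' R)
    (Y : {RV Q >-> R}) : Prop :=
  forall x : R, {for x, continuous (cdf Y)} ->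
    cdf (X n) x @[n --> \oo] --> cdf Y x.

(* Main.v *)
From Pilot Require Import Defs.
From HB Require Import structures.
From mathcomp Require Import all_boot all_order all_algebra.
From mathcomp Require Import all_classical all_reals all_analysis.
From mathcomp Require Import ring lra zify.
Import Order.TTheory GRing.Theory Num.Theory.
Import numFieldNormedType.Exports.

Set Implicit Arguments.
Unset Strict Implicit.
Unset Printing Implicit Defensive.

(** Write [f n] for the number of planar graphs on [n] labelled vertices divided
    by [n!], and [alpha s] for the same quotient for the class [A].  The Poisson
    law comes out of one regularity property of planar graphs, their smoothness:
    [f n / f n.+1] converges, necessarily to [planar_rho] ([planar_ratio_cvg],
    [ratio_root]).

    Smoothness implies the theorem.  A planar graph with a marked component in
    the class is the disjoint union of a member of the class and of an arbitrary
    planar graph on the remaining vertices, and every such union is planar.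
    Hence the factorial moments of the number [X] of components in the class
    satisfy an exact convolution ([marking], [fact_momentS]):
      [E_n (X)_(k+1) = sum_s alpha s * (f (n - s) / f n) * E_(n - s) (X)_k].
    Here [f (n - s) / f n] tends to [rho ^ s] and is at most [C * r ^ s] for any
    [r > rho]; with [r] inside the disc of convergence of the series of [A] the
    sum is dominated, so [E_n (X)_k] tends to [A(rho) ^ k] and stays below
    [L ^ k] for a constant [L].  The probability of [X = j] is an alternating sum
    of factorial moments, dominated by an exponential series, and its limit is
    the Poisson weight ([prob_cvg]).

    Smoothness follows from two facts about planar graphs.
    - A leaf can be attached at any vertex.  So the mean number of leaves of a
      uniform planar graph on [n] vertices is [(n - 1) * f (n - 1) / f n].
      Deleting a leaf destroys at most one more leaf, and the Cauchy-Schwarz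
      inequality turns this into [(n - 1) r_n <= (n - 2) r_(n-1) + 2] for
      [r_n = f (n - 1) / f n] ([leaf_ineq]): the ratio can only rise slowly.
    - Two connected planar graphs can be linked through a new vertex
      ([glue_ineq]), and any planar graph becomes connected when a new vertex is
      joined to one vertex of each component ([planar_le_conn]).  This gives a
      supermultiplicative sequence comparable to [f], hence an exponential
      growth rate.
    A ratio that is too large (too small) at [n] is too large (too small) on a
    window of length proportional to [n] before (after) [n], by slow rise, and
    this contradicts the growth rate ([ratio_cvg]).

    The only geometric input is that an edge may be added between two components
    of a planar graph ([planar_join]).  Near a vertex [x] the arcs can be made
    radial, so that some point [c] off the drawing is seen from [x] along a free
    segment ([accessible]).  The map [z |-> (p x - c) / (z - c)] of the complex
    plane turns this segment into a free ray from [x] to infinity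
    ([drawing_ray]).  Two bounded drawings with such rays are put side by side,
    rays facing each other, and the new edge runs along the rays. *)

(** * Arcs and plane drawings *)

Section Drawings.
Local Open Scope classical_set_scope.
Local Open Scope ring_scope.
Variable R : realType.
Implicit Types (V W : finType).

(** Precomposing an arc with [clamp] makes it continuous on the whole line, so that
    subspace topologies can be forgotten. *)
Definition clamp (t : R) : R := Num.max 0 (Num.min 1 t).

Lemma clamp_in t : clamp t \in `[0, 1].
Proof. by rewrite in_itv /= /clamp le_max lexx /= ge_max ler01 ge_min lexx. Qed.

Lemma clampE t : t \in `[0, 1] -> clamp t = t.
Proof.
by rewrite in_itv /= /clamp => /andP[t0 t1]; rewrite min_r // max_r.
Qed.

Lemma clamp_continuous : continuous clamp.
Proof.
move=> x; rewrite /clamp; apply: continuous_max; first exact: cst_continuous.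
by apply: continuous_min; [exact: cst_continuous | exact: cvg_id].
Qed.

Lemma continuous_comp_clamp (U : topologicalType) (f : R -> U) :
  {within `[0, 1], continuous f} -> continuous (f \o clamp).
Proof.
move=> /subspace_continuousP cf x A /= nA.
have := cf (clamp x) (clamp_in x) A nA.
rewrite /= nbhs_simpl => H.
have H2 := @clamp_continuous x _ H.
have H3 : nbhs x [set y | clamp y \in `[0, 1] -> A (f (clamp y))] by exact: H2.
exact: (filterS (fun y h => h (clamp_in y)) H3).
Qed.

(** The data of [planar], with arcs continuous everywhere; see [planarP]. *)
Definition drawing V (G : sgraph V) (p : V -> R * R) (arc : {set V} -> R -> R * R) :=
  [/\ injective p,
      forall e, e \in edges G ->
        [/\ continuous (arc e),
            {in `[0, 1] &, injective (arc e)} &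
            exists u v, [/\ e = [set u; v]%SET, arc e 0 = p u & arc e 1 = p v]],
      forall e (t : R) v, e \in edges G -> t \in `]0, 1[ -> arc e t <> p v &
      forall e e' (s t : R), e \in edges G -> e' \in edges G -> e != e' ->
        s \in `]0, 1[ -> t \in `]0, 1[ -> arc e s <> arc e' t].

Lemma itv01_0 : (0:R) \in `[0, 1]. Proof. by rewrite in_itv /= lexx ler01. Qed.
Lemma itv01_1 : (1:R) \in `[0, 1]. Proof. by rewrite in_itv /= lexx ler01. Qed.
Lemma itv_oo_cc (t : R) : t \in `]0, 1[ -> t \in `[0, 1].
Proof. exact: subset_itv_oo_cc. Qed.

Lemma planarP V (G : sgraph V) : planar R G <-> exists p arc, drawing G p arc.
Proof.
split=> -[p [arc [pI He Hv Hd]]].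
  exists p, (fun e => arc e \o clamp); split => //.
  - move=> e /He[ce ie [u [v [ee e0 e1]]]]; split; first exact: continuous_comp_clamp.
      by move=> s t sI tI /=; rewrite !clampE //; exact: ie.
    by exists u, v; rewrite /= !clampE ?itv01_0 ?itv01_1.
  - by move=> e t v eE tI; rewrite /= clampE ?itv_oo_cc //; exact: Hv.
  - by move=> e e' s t eE e'E ne sI tI; rewrite /= !clampE ?itv_oo_cc //; exact: Hd.
exists p, arc; split => // e /He[ce ie ex]; split => //.
exact: continuous_subspaceT.
Qed.

(** Extracts a common radius from finitely many vertices or edges. *)
Lemma finite_pos (I : finType) (P : I -> R -> Prop) :
  (forall i r s, P i r -> 0 < s -> s <= r -> P i s) ->
  (forall i, exists2 r, 0 < r & P i r) -> exists2 r, 0 < r & forall i, P i r.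
Proof.
move=> mono H.
have /boolp.choice[f fP] : forall i, exists r, 0 < r /\ P i r.
  by move=> i; have [r] := H i; exists r.
exists (\big[Num.min/1]_i f i).
  by apply: lt_bigmin => // i _; have [] := fP i.
move=> i; have [fi Pi] := fP i; apply: mono Pi _ _.
  by apply: lt_bigmin => // j _; have [] := fP j.
exact: bigmin_le_cond.
Qed.

Lemma continuous_norm_sub (f : R -> R * R) (c : R * R) :
  continuous f -> continuous (fun t => `|f t - c|).
Proof.
move=> cf t; apply: cvg_norm.
by apply: cvgB; [exact: cf | exact: cvg_cst].
Qed.

Lemma arc_away (f : R -> R * R) (c : R * R) : continuous f ->
  (forall t, t \in `[0, 1] -> f t <> c) ->
  exists2 r, 0 < r & forall t, t \in `[0, 1] -> r < `|f t - c|.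
Proof.
move=> cf fc.
have cg : {within `[0, 1], continuous (fun t => `|f t - c|)}.
  by apply: continuous_subspaceT; exact: continuous_norm_sub.
have [t0 t0I H] := EVT_min ler01 cg.
have h0 : 0 < `|f t0 - c| by rewrite normr_gt0 subr_eq0; apply/eqP/fc.
exists (`|f t0 - c| / 2) => [|t /H]; first by rewrite divr_gt0.
by apply: lt_le_trans; rewrite ltr_pdivrMr // ltr_pMr // ltr1n.
Qed.

(** [tau] is the supremum of the closed set of times spent in the ball; the arc is
    on the sphere at that time, else it would stay inside a little longer. *)
Lemma last_exit (f : R -> R * R) (r : R) : continuous f ->
  0 < r -> r < `|f 1 - f 0| ->
  exists tau, [/\ tau \in `]0, 1[, `|f tau - f 0| = r &
    forall t, t \in `[0, 1] -> tau < t -> r < `|f t - f 0|].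
Proof.
move=> cf r0 r1.
pose h t := `|f t - f 0|.
have ch : continuous h by exact: continuous_norm_sub.
pose S := [set t | t \in `[0, 1] /\ h t <= r].
have S0 : S 0 by split; [exact: itv01_0 | rewrite /h subrr normr0 ltW].
have ubS : ubound S 1 by move=> t [] ; rewrite in_itv /= => /andP[].
have hasS : has_sup S by split; [exists 0 | exists 1].
have tau0 : 0 <= sup S by exact: ub_le_sup hasS.2 _ S0.
have tau1 : sup S <= 1 by apply: ge_sup => //; exists 0.
have cS : closed S.
  have -> : S = `[0, 1] `&` h @^-1` [set x | x <= r].
    by apply/seteqP; split => t [].
  apply: closedI; first exact: itv_closed.
  by apply: preimage_closed => //; exact: closed_le.
have [tauI htau] : S (sup S).
  have : closure S (sup S) by apply: closure_sup; [exists 0 | exists 1].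
  by rewrite -((closure_id S).1 cS).
have ht : h (sup S) = r.
  apply/eqP; rewrite eq_le htau /= leNgt; apply/negP => lt_h.
  have : \forall t \near sup S, h t < r.
    have nr : nbhs (h (sup S)) [set x | x < r] by exact: lt_nbhsl.
    exact: (ch (sup S) _ nr).
  move=> /nbhs_ballP[e /= e0 He].
  have lt1 : sup S < 1.
    rewrite lt_neqAle tau1 andbT; apply/eqP => s1; move: lt_h.
    by rewrite s1 ltNge /h ltW.
  pose t := Num.min (sup S + e / 2) 1.
  have tS : sup S < t by rewrite lt_min lt1 andbT ltrDl divr_gt0.
  have t1 : t <= 1 by rewrite ge_min lexx orbT.
  have te : t - sup S <= e / 2 by rewrite lerBlDl ge_min lexx.
  suff : S t by move=> /(ub_le_sup hasS.2); rewrite leNgt tS.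
  split; first by rewrite in_itv /= t1 (le_trans tau0 (ltW tS)).
  apply/ltW/He; rewrite /ball /= ltr_distlC.
  lra.
exists (sup S); split => //.
  rewrite in_itv /= !lt_neqAle tau0 tau1 !andbT; apply/andP; split; apply/eqP => E.
    by move: ht r0; rewrite -E /h subrr normr0 => <-; rewrite ltxx.
  by move: r1; rewrite -ht E /h ltxx.
move=> t tI tt; rewrite ltNge; apply/negP => hr.
have /(ub_le_sup hasS.2) : S t by [].
by rewrite leNgt tt.
Qed.

(** Replace the arc up to its last exit from the ball by the radius ending at the
    exit point [b].  The rest of the arc stays outside the ball, so the new arc is
    injective, and it meets the ball in a radius only. *)
Lemma radial_start (f : R -> R * R) (r : R) : continuous f ->
  {in `[0, 1] &, injective f} -> 0 < r -> r < `|f 1 - f 0| ->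
  exists (g : R -> R * R) (b : R * R),
  [/\ continuous g, {in `[0, 1] &, injective g}, g 0 = f 0 /\ g 1 = f 1,
      `|b - f 0| = r /\ exists2 t, t \in `]0, 1[ & b = f t &
      forall t, t \in `]0, 1[ ->
        (r < `|g t - f 0| /\ exists2 t', t' \in `]0, 1[ & g t = f t') \/
        (exists s, [/\ 0 < s, s <= 1 & g t = f 0 + s *: (b - f 0)])].
Proof.
move=> cf fI r0 r1.
have [tau [tauI hb far]] := last_exit cf r0 r1.
have [tau0 tau1] : 0 < tau /\ tau < 1 by move: tauI; rewrite in_itv => /andP.
set b := f tau.
(* the segment stopped at tau plus the old arc started at tau: a continuous
   formula for the concatenation *)
pose g t := f 0 + (Num.min t tau / tau) *: (b - f 0) + (f (Num.max t tau) - b).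
have gl t : t <= tau -> g t = f 0 + (t / tau) *: (b - f 0).
  by move=> tt; rewrite /g min_l // max_r // subrr addr0.
have gr t : tau <= t -> g t = f t.
  move=> tt; rewrite /g min_r // max_l // divff ?gt_eqF // scale1r.
  by rewrite [f 0 + _]addrC subrK addrC subrK.
have ngl t : 0 <= t -> t <= tau -> `|g t - f 0| = t / tau * r.
  move=> t0 tt; rewrite gl // addrAC subrr add0r normrZ hb ger0_norm //.
  by rewrite divr_ge0 // ltW.
have gle t : 0 <= t -> t <= tau -> `|g t - f 0| <= r.
  move=> t0 tt; rewrite ngl //; apply: ler_piMl; first exact: ltW.
  by rewrite ler_pdivrMr // mul1r.
have ggt t : t <= 1 -> tau < t -> r < `|g t - f 0|.
  move=> t1 tt; rewrite gr ?ltW //; apply: far => //.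
  by rewrite in_itv /= t1 (ltW (lt_trans tau0 tt)).
exists g, b; split.
- move=> t; rewrite /g; apply: cvgD; last first.
    apply: cvgB; last exact: cvg_cst.
    apply: (@continuous_comp _ _ _ (fun t => Num.max t tau)); last exact: cf.
    by apply: continuous_max; [exact: cvg_id | exact: cvg_cst].
  apply: cvgD; first exact: cvg_cst.
  apply: cvgZr_tmp; apply: cvgMr_tmp.
  by apply: continuous_min; [exact: cvg_id | exact: cvg_cst].
- move=> s t; rewrite !in_itv /= => /andP[s0 s1] /andP[t0 t1] E.
  have [st|st] := leP s tau; have [tt|tt] := leP t tau.
  + have : `|g s - f 0| = `|g t - f 0| by rewrite E.
    rewrite !ngl // => /(mulIf (lt0r_neq0 r0)) /mulIf; apply.
    by rewrite invr_neq0 // gt_eqF.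
  + by have := gle s s0 st; rewrite E leNgt ggt.
  + by have := gle t t0 tt; rewrite -E leNgt ggt.
  + by apply: fI; rewrite ?in_itv /= ?s0 ?s1 ?t0 ?t1 // -!gr ?E // ltW.
- by rewrite gl ?ltW // mul0r scale0r addr0 gr // ltW.
- by split => //; exists tau.
move=> t; rewrite in_itv /= => /andP[t0 t1]; have [tt|tt] := leP t tau.
  right; exists (t / tau); rewrite gl // divr_gt0 //; split => //.
  by rewrite ler_pdivrMr // mul1r.
left; rewrite ggt ?ltW //; split => //; exists t; last by rewrite gr // ltW.
by rewrite in_itv /= t0 t1.
Qed.

Lemma itv01_cases (t : R) : t \in `[0, 1] -> [\/ t = 0, t = 1 | t \in `]0, 1[].
Proof.
rewrite !in_itv /= => /andP[]; rewrite le_eqVlt => /predU1P[<-|t0]; first by constructor.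
rewrite le_eqVlt => /predU1P[->|t1]; first by constructor 2.
by constructor 3; rewrite t0 t1.
Qed.

(** A point [c] which sees the vertex [x] along a segment free of the drawing.  In a
    small ball around [x], for the sup norm, only arcs of edges at [x] occur;
    after [radial_start] they are finitely many radii, and any other radius is
    free.  Distinct edges give distinct radii because their exit points lie on
    disjoint arcs. *)
Lemma accessible V (G : sgraph V) (x : V) : planar R G ->
  exists (p : V -> R * R) arc c, [/\ drawing G p arc,
    forall e t s, e \in edges G -> t \in `[0, 1] -> 0 < s -> s <= 1 ->
      arc e t <> p x + s *: (c - p x),
    forall v s, 0 < s -> s <= 1 -> p v <> p x + s *: (c - p x) &
    c <> p x].
Proof.
move=> /planarP[p [arc [pI He Hv Hd]]].
have [r1 r10 Hr1] : exists2 r : R, 0 < r & forall v, v != x -> r < `|p v - p x|.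
  apply: (@finite_pos V (fun v r => v != x -> r < `|p v - p x|)).
    by move=> v r s h _ sr vx; apply: le_lt_trans sr _; exact: h.
  move=> v; have [->|vx] := eqVneq v x; first by exists 1.
  exists (`|p v - p x| / 2) => [|_].
    by rewrite divr_gt0 // normr_gt0 subr_eq0 (inj_eq pI).
  rewrite ltr_pdivrMr // ltr_pMr ?ltr1n //.
  by rewrite normr_gt0 subr_eq0 (inj_eq pI).
have nE e t v : e \in edges G -> v \notin e -> t \in `[0, 1] -> arc e t <> p v.
  move=> eE ve /itv01_cases[->|->|tI]; last exact: Hv.
    have [_ _ [u [w [ee -> _]]]] := He e eE; move=> /pI uv.
    by move: ve; rewrite ee !finset.inE uv eqxx.
  have [_ _ [u [w [ee _ ->]]]] := He e eE; move=> /pI uv.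
  by move: ve; rewrite ee !finset.inE uv eqxx orbT.
have [r2 r20 Hr2] : exists2 r : R, 0 < r & forall e : {set V}, e \in edges G ->
    x \notin e -> forall t, t \in `[0, 1] -> r < `|arc e t - p x|.
  apply: (@finite_pos {set V} (fun e r => e \in edges G ->
    x \notin e -> forall t, t \in `[0, 1] -> r < `|arc e t - p x|)).
    move=> e r s h _ sr eE xe t tI; apply: le_lt_trans sr _; exact: h.
  move=> e; case: (boolP (e \in edges G)) => eE; last by exists 1.
  case: (boolP (x \in e)) => xe; first by exists 1.
  have [ce _ _] := He e eE.
  have [|r r0 h] := @arc_away (arc e) (p x) ce; last by exists r.
  by move=> t tI; exact: nE.
pose r := Num.min r1 r2.
have r0 : 0 < r by rewrite lt_min r10.
have {r10}Hr1 v : v != x -> r < `|p v - p x|.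
  by move=> vx; apply: le_lt_trans (Hr1 v vx); rewrite ge_min lexx.
have {r20}Hr2 e t : e \in edges G -> x \notin e -> t \in `[0, 1] -> r < `|arc e t - p x|.
  by move=> eE xe tI; apply: le_lt_trans (Hr2 e eE xe t tI); rewrite ge_min lexx orbT.
(* the new arc of e and its exit point; when x is an end of e, the arc starts
   at x *)
pose spec (e : {set V}) (gb : (R -> R * R) * (R * R)) := e \in edges G ->
  [/\ continuous gb.1, {in `[0, 1] &, injective gb.1},
      exists u v, [/\ e = [set u; v]%SET, gb.1 0 = p u & gb.1 1 = p v],
      x \in e -> `|gb.2 - p x| = r /\ exists2 t, t \in `]0, 1[ & gb.2 = arc e t &
      forall t, t \in `]0, 1[ ->
        (r < `|gb.1 t - p x| /\ exists2 t', t' \in `]0, 1[ & gb.1 t = arc e t') \/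
        (x \in e /\ exists s, [/\ 0 < s, s <= 1 & gb.1 t = p x + s *: (gb.2 - p x)])].
have /boolp.choice[gb gbP] : forall e, exists gb, spec e gb.
  move=> e; case: (boolP (e \in edges G)) => eE; last by exists (arc e, 0); rewrite /spec (negbTE eE).
  have [ce ie [u [w [ee e0 e1]]]] := He e eE.
  have uw : u != w.
    by have := forall_inP (edges_card2 G) _ eE; rewrite ee cards2 eqSS eqb1.
  case: (boolP (x \in e)) => xe; last first.
    exists (arc e, 0) => _; split => //=; first by exists u, w.
    - by rewrite (negbTE xe).
    - by move=> t tI; left; split; [exact: Hr2 (itv_oo_cc tI) | exists t].
  have [xu|xu] := eqVneq u x.
    have rr : r < `|arc e 1 - arc e 0|.
      by rewrite e0 e1 xu; apply: Hr1; rewrite -xu eq_sym.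
    have [g [b [cg ig [g0 g1] hb hg]]] := radial_start ce ie r0 rr.
    rewrite e0 xu in hb hg.
    exists (g, b) => _; split => //=; first by exists u, w; rewrite g0 g1.
    by move=> t /hg[]; [left | right].
  have xw : w = x by apply/eqP; move: xe; rewrite ee !finset.inE eq_sym (negbTE xu) eq_sym.
  have ac : continuous (fun t : R => arc e (1 - t)).
    move=> t; apply: (@continuous_comp _ _ _ (fun t : R => 1 - t)); last exact: ce.
    by apply: cvgB; [exact: cvg_cst | exact: cvg_id].
  have ai : {in `[0, 1] &, injective (fun t : R => arc e (1 - t))}.
    move=> s t sI tI /ie E; have : 1 - s = 1 - t.
      by apply: E; move: sI tI; rewrite !in_itv /=; lra.
    lra.
  have rr : r < `|arc e (1 - 1) - arc e (1 - 0)|.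
    by rewrite subrr subr0 e0 e1 xw; apply: Hr1.
  have [g [b [cg ig [g0 g1] [hb1 [t0 t0I hb2]] hg]]] := radial_start ac ai r0 rr.
  rewrite /= subr0 e1 xw in g0 hb1 hg; rewrite /= subrr e0 in g1.
  exists (g, b) => _; split => //=; first by exists w, u; rewrite g0 g1 xw finset.setUC -xw.
    move=> _; split => //; exists (1 - t0) => //.
    by move: t0I; rewrite !in_itv /=; lra.
  move=> t /hg[[h [t' t'I ht']]|]; [left | by right].
  split => //; exists (1 - t') => //.
  by move: t'I; rewrite !in_itv /=; lra.
(* c is sought on the side of the square whose points are p x + (r, r * u),
   0 < u <= 1, so that finitely many values of u are forbidden *)
have [u [u0 u1] Hu] : exists2 u : R, 0 < u /\ u <= 1 &
    forall e, e \in edges G -> x \in e -> ((gb e).2 - p x).2 / r != u.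
  have [||u u0 Hu] := @finite_pos {set V}
    (fun e u => let w := ((gb e).2 - p x).2 / r in w <= 0 \/ u < w).
  - by move=> e a b /= [h|h] _ ba; [left | right; exact: le_lt_trans h].
  - move=> e /=; set w := _ / r; have [w0|w0] := leP w 0.
      by exists 1 => //; left.
    exists (w / 2); first by rewrite divr_gt0.
    by right; rewrite -/w ltr_pdivrMr // ltr_pMr // ltr1n.
  exists (Num.min u 1); first by rewrite lt_min u0 ltr01 ge_min lexx orbT.
  move=> e eE xe; have [/= h|/= h] := Hu e.
    by rewrite lt_eqF // (le_lt_trans h) // lt_min u0 ltr01.
  by rewrite gt_eqF // (le_lt_trans _ h) // ge_min lexx.
pose c := p x + (r, r * u).
have cx : c - p x = (r, r * u) by rewrite /c addrAC subrr add0r.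
have nc : `|c - p x| = r.
  rewrite cx prod_normE /= normrM !gtr0_norm // max_l //.
  by apply: ler_piMr => //; exact: ltW.
have cb e : e \in edges G -> x \in e -> c != (gb e).2.
  move=> eE xe; apply/eqP => E; have := Hu e eE xe.
  by rewrite -E cx /= [r * u]mulrC mulfK ?eqxx // gt_eqF.
have nsc s : 0 < s -> `|p x + s *: (c - p x) - p x| = s * r.
  by move=> s0; rewrite addrAC subrr add0r normrZ nc gtr0_norm.
have pv v s : 0 < s -> s <= 1 -> p v <> p x + s *: (c - p x).
  move=> s0 s1 E; have [vx|vx] := eqVneq v x.
    have : `|p v - p x| = s * r by rewrite E nsc.
    by rewrite vx subrr normr0 => /esym/eqP; rewrite mulf_eq0 !gt_eqF.
  have := Hr1 v vx; rewrite E nsc // ltNge => /negP; apply.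
  by apply: ler_piMl => //; exact: ltW.
have nearE s s' b b' : 0 < s -> 0 < s' -> `|b - p x| = r -> `|b' - p x| = r ->
    p x + s *: (b - p x) = p x + s' *: (b' - p x) -> b = b'.
  move=> s0 s'0 hb hb' /addrI E.
  have : `|s *: (b - p x)| = `|s' *: (b' - p x)| by rewrite E.
  rewrite !normrZ hb hb' !gtr0_norm // => /(mulIf (lt0r_neq0 r0)) ss.
  move: E; rewrite ss => /(scalerI (lt0r_neq0 s'0)) => /eqP.
  by rewrite (inj_eq (addIr _)) => /eqP.
exists p, (fun e => (gb e).1), c; split.
- split => //.
  + by move=> e eE; have [? ? ? _ _] := gbP e eE.
  + move=> e t v eE tI E; have [_ _ _ hb /(_ t tI)] := gbP e eE.
    case=> [[_ [t' t'I ht']]|[xe [s [s0 s1 hs]]]].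
      by apply: (Hv e t' v) => //; rewrite -ht'.
    have [hb1 _] := hb xe.
    have ns : `|p v - p x| = s * r.
      by rewrite -E hs addrAC subrr add0r normrZ hb1 gtr0_norm.
    have [vx|vx] := eqVneq v x.
      by move: ns; rewrite vx subrr normr0 => /esym/eqP; rewrite mulf_eq0 !gt_eqF.
    have := Hr1 v vx; rewrite ns ltNge => /negP; apply.
    by apply: ler_piMl => //; exact: ltW.
  + move=> e e' s t eE e'E ee sI tI E.
    have [_ _ _ hb' /(_ t tI) C'] := gbP e' e'E.
    have [_ _ _ hb /(_ s sI) C] := gbP e eE.
    have mix e1 t1 t2 e2 : e1 \in edges G -> (x \in e1 -> `|(gb e1).2 - p x| = r /\
        exists2 t, t \in `]0, 1[ & (gb e1).2 = arc e1 t) -> x \in e1 ->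
        (gb e2).1 t2 = (gb e1).1 t1 ->
        r < `|(gb e2).1 t2 - p x| -> (exists s, [/\ 0 < s, s <= 1 &
         (gb e1).1 t1 = p x + s *: ((gb e1).2 - p x)]) -> False.
      move=> e1E h1 /h1[hr _] Eq + [a [a0 a1 ha]].
      rewrite Eq ha addrAC subrr add0r normrZ hr gtr0_norm // ltNge => /negP; apply.
      by apply: ler_piMl => //; exact: ltW.
    case: C C' => [[f1 [t1 t1I h1]]|[x1 n1]] [[f2 [t2 t2I h2]]|[x2 n2]].
    * by apply: (Hd e e' t1 t2) => //; rewrite -h1 -h2.
    * by apply: (mix e' t s e).
    * by apply: (mix e s t e').
    * case: n1 n2 => [a [a0 a1 ha]] [a' [a'0 a'1 ha']].
      have [h1 [t1 t1I g1]] := hb x1; have [h2 [t2 t2I g2]] := hb' x2.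
      have bb : (gb e).2 = (gb e').2.
        by apply: (nearE a a') => //; rewrite -ha -ha'.
      by apply: (Hd e e' t1 t2) => //; rewrite -g1 -g2.
- move=> e t s eE tI s0 s1.
  have [_ _ [v [w [_ e0 e1]]] hb hg] := gbP e eE.
  case/itv01_cases: tI => [->|->|tI].
  + by rewrite e0; exact: pv.
  + by rewrite e1; exact: pv.
  case: (hg t tI) => [[far _]|[xe [a [a0 a1 ->]]]].
    move=> E; move: far; rewrite E nsc // ltNge => /negP; apply.
    by apply: ler_piMl => //; exact: ltW.
  have [hr _] := hb xe.
  move=> /nearE => /(_ a0 s0 hr nc) E.
  by have := cb e eE xe; rewrite E eqxx.
- exact: pv.
- by move=> E; move: nc; rewrite E subrr normr0 => rr; move: r0; rewrite -rr ltxx.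
Qed.

(** The quotient [u / w] of complex numbers written in coordinates. *)
Definition cdiv (u w : R * R) : R * R :=
  ((u.1 * w.1 + u.2 * w.2) / (w.1 ^+ 2 + w.2 ^+ 2),
   (u.2 * w.1 - u.1 * w.2) / (w.1 ^+ 2 + w.2 ^+ 2)).

Lemma sqn_neq0 (w : R * R) : w != 0 -> w.1 ^+ 2 + w.2 ^+ 2 != 0.
Proof.
case: w => a b /=; apply: contra; rewrite paddr_eq0 ?sqr_ge0 // !sqrf_eq0.
by move=> /andP[/eqP-> /eqP->].
Qed.

(** [w |-> u / w] is an involution, hence injective away from 0. *)
Lemma cdivK u w : u != 0 -> w != 0 -> cdiv u (cdiv u w) = w.
Proof.
move=> /sqn_neq0 u0 /sqn_neq0 w0; case: u w u0 w0 => [a b] [c d] /= u0 w0.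
have E : ((a * c + b * d) / (c ^+ 2 + d ^+ 2)) ^+ 2 +
  ((b * c - a * d) / (c ^+ 2 + d ^+ 2)) ^+ 2 = (a ^+ 2 + b ^+ 2) / (c ^+ 2 + d ^+ 2).
  by field.
by rewrite /cdiv /= E; congr (_, _); field; rewrite u0 w0.
Qed.

(** A point of the real axis comes from the line through 0 and [u]. *)
Lemma cdiv_ray u (s : R) : s != 0 -> cdiv u (s, 0) = s^-1 *: u.
Proof.
case: u => a b s0; rewrite /cdiv /= !mulr0 subr0 addr0 expr0n /= addr0.
have E z : z * s / s ^+ 2 = s^-1 * z by field.
by rewrite !E.
Qed.

Lemma cdiv_continuous u w : w != 0 -> {for w, continuous (cdiv u)}.
Proof.
move=> /sqn_neq0 w0.
have c1 : (fun z : R * R => z.1) @ w --> w.1 by exact: cvg_fst.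
have c2 : (fun z : R * R => z.2) @ w --> w.2 by exact: cvg_snd.
have cq : (fun z : R * R => (z.1 ^+ 2 + z.2 ^+ 2)^-1) @ w --> (w.1 ^+ 2 + w.2 ^+ 2)^-1.
  by apply: cvgV => //; apply: cvgD; apply: cvgM.
rewrite /prop_for /continuous_at /cdiv.
apply: (@cvg_pair _ _ _ (nbhs w) (nbhs _) (nbhs _)); apply: cvgM => //.
  by apply: cvgD; apply: cvgMl_tmp.
by apply: cvgB; apply: cvgMl_tmp.
Qed.

Lemma arc_bounded (f : R -> R * R) : continuous f ->
  exists M, forall t, t \in `[0, 1] -> `|f t| <= M.
Proof.
move=> cf.
have cg : {within `[0, 1], continuous (fun t => `|f t|)}.
  by apply: continuous_subspaceT => t; apply: cvg_norm; exact: cf.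
by have [t0 t0I H] := EVT_max ler01 cg; exists `|f t0|.
Qed.

Lemma finite_ub (I : finType) (P : I -> R -> Prop) :
  (forall i r s, P i r -> r <= s -> P i s) ->
  (forall i, exists r, P i r) -> exists r, forall i, P i r.
Proof.
move=> mono /boolp.choice[f fP].
exists (\big[Num.max/0]_i f i) => i; apply: mono (fP i) _.
exact: le_bigmax.
Qed.

(** Apply [z |-> (p x - c) / (z - c)] to the drawing given by [accessible]: [p x] goes
    to 1, the segment from [p x] to [c] to the half-line above 1, and the drawing
    becomes bounded because it stays away from [c]. *)
Lemma drawing_ray V (G : sgraph V) (x : V) : planar R G ->
  exists (p : V -> R * R) arc M, [/\ drawing G p arc, p x = (1, 0),
    (forall e t, e \in edges G -> t \in `[0, 1] -> `|arc e t| <= M),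
    (forall v, `|p v| <= M) &
    (forall e t s, e \in edges G -> t \in `[0, 1] -> 1 < s -> arc e t <> (s, 0)) /\
    (forall v s, 1 < s -> p v <> (s, 0))].
Proof.
move=> /(accessible x)[p [arc [c [[pI He Hv Hd] freeE freeV cpx]]]].
pose u := p x - c.
have u0 : u != 0 by rewrite subr_eq0; apply/eqP => /esym.
have pc v : p v - c != 0.
  rewrite subr_eq0; apply/eqP => E; apply: (freeV v 1) => //.
  by rewrite scale1r addrC subrK.
have ac e t : e \in edges G -> t \in `[0, 1] -> arc e t - c != 0.
  move=> eE tI; rewrite subr_eq0; apply/eqP => E; apply: (freeE e t 1) => //.
  by rewrite scale1r addrC subrK.
pose q v := cdiv u (p v - c).
pose g e t := cdiv u (arc e (clamp t) - c).
have gE e t : t \in `[0, 1] -> g e t = cdiv u (arc e t - c).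
  by move=> tI; rewrite /g clampE.
have mI z z' : z - c != 0 -> z' - c != 0 -> cdiv u (z - c) = cdiv u (z' - c) -> z = z'.
  move=> z0 z'0 E; apply: (addIr (- c)).
  by rewrite -(cdivK u0 z0) E cdivK.
have gc e : e \in edges G -> continuous (g e).
  move=> eE t; rewrite /g.
  apply: (@continuous_comp _ _ _ (fun t => arc e (clamp t) - c) (cdiv u)); last first.
    by apply: cdiv_continuous; apply: ac => //; exact: clamp_in.
  apply: cvgB; last exact: cvg_cst.
  have [ce _ _] := He e eE.
  by apply: (@continuous_comp _ _ _ clamp); [exact: clamp_continuous | exact: ce].
have [M1 HM1] : exists M, forall e, e \in edges G -> forall t, t \in `[0, 1] -> `|g e t| <= M.
  apply: (@finite_ub {set V} (fun e M => e \in edges G -> forall t, t \in `[0, 1] -> `|g e t| <= M)).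
    by move=> e r s h rs eE t tI; apply: le_trans rs; exact: h.
  move=> e; case: (boolP (e \in edges G)) => eE; last by exists 0.
  by have [M HM] := arc_bounded (gc e eE); exists M.
have [M2 HM2] : exists M, forall v, `|q v| <= M.
  apply: (@finite_ub V (fun v M => `|q v| <= M)); last by move=> v; exists `|q v|.
  by move=> v r s h rs; exact: le_trans rs.
have ray z s : 1 < s -> z - c != 0 -> cdiv u (z - c) = (s, 0) ->
    [/\ 0 < 1 - s^-1, 1 - s^-1 <= 1 & z = p x + (1 - s^-1) *: (c - p x)].
  move=> s1 zc E; have s0 : 0 < s by apply: lt_trans s1.
  split.
  - by rewrite subr_gt0 invf_lt1.
  - by rewrite gerBl invr_ge0 ltW.
  have : z - c = s^-1 *: u.
    by rewrite -(cdivK u0 zc) E cdiv_ray // gt_eqF.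
  move=> /eqP; rewrite subr_eq => /eqP ->.
  rewrite scalerBl scale1r addrA subrKC -[c - p x]opprB scalerN opprK.
  by rewrite addrC.
exists q, g, (Num.max M1 M2); split.
- split.
  + by move=> v w /mI; move=> /(_ (pc v) (pc w)) /pI.
  + move=> e eE; have [ce ie [a [b [ee e0 e1]]]] := He e eE; split.
    * exact: gc.
    * move=> s t sI tI; rewrite !gE // => /mI E; apply: ie => //.
      by apply: E; exact: ac.
    * by exists a, b; rewrite !gE ?itv01_0 ?itv01_1 // e0 e1.
  + move=> e t v eE tI; rewrite gE ?itv_oo_cc // => /mI E.
    by apply: (Hv e t v) => //; apply: E; [exact: ac (itv_oo_cc tI) | exact: pc].
  + move=> e e' s t eE e'E ee sI tI; rewrite !gE ?itv_oo_cc // => /mI E.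
    by apply: (Hd e e' s t) => //; apply: E; apply: ac => //; exact: itv_oo_cc.
- rewrite /q -/u /cdiv; congr (_, _).
    by rewrite -!expr2 divff // sqn_neq0.
  by rewrite [u.2 * _]mulrC subrr mul0r.
- by move=> e t eE tI; rewrite le_max HM1.
- by move=> v; rewrite le_max HM2 orbT.
split.
- move=> e t s eE tI s1; rewrite gE // => /ray[] //; first exact: ac.
  by move=> h0 h1; exact: freeE.
- by move=> v s s1 /ray[] // h0 h1; exact: freeV.
Qed.

Lemma planar_embed V W (f : W -> V) (G : sgraph V) (H : sgraph W) :
  injective f -> (forall e, e \in edges H -> (f @: e)%SET \in edges G) ->
  planar R G -> planar R H.
Proof.
move=> fI sub /planarP[p [arc [pI He Hv Hd]]]; apply/planarP.
exists (p \o f), (fun e : {set W} => arc (f @: e)%SET); split.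
- exact: inj_comp.
- move=> e /sub/He[ce ie [u [v [ee e0 e1]]]]; split => //.
  have : u \in (f @: e)%SET by rewrite ee !finset.inE eqxx.
  case/imsetP=> u' u'e uE.
  have : v \in (f @: e)%SET by rewrite ee !finset.inE eqxx orbT.
  case/imsetP=> v' v'e vE.
  exists u', v'; rewrite /= -uE -vE; split => //.
  by apply: (imset_inj fI); rewrite ee imsetU1 imset_set1 -uE -vE.
- by move=> e t v /sub eE tI; exact: Hv.
- move=> e e' s t eE e'E ee; apply: Hd; [exact: sub | exact: sub |].
  by rewrite (inj_eq (imset_inj fI)).
Qed.

(** The drawing of [G1] keeps its position, that of [G2] is reflected and translated
    far to the right.  The free rays of [x] and [y] then overlap along a horizontal
    segment, which serves as the arc of the edge between [x] and [y]. *)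
Lemma planar_join V (S : {set V}) (G1 G2 G : sgraph V) (x y : V) :
  planar R G1 -> planar R G2 -> x \in S -> y \notin S ->
  (forall e, e \in edges G ->
     [\/ e \in edges G1 /\ e \subset S, e \in edges G2 /\ e \subset ~: S
       | e = [set x; y]%SET]) ->
  planar R G.
Proof.
move=> /(drawing_ray x)[p1 [a1 [M1 [[p1I H1e H1v H1d] p1x a1M p1M [a1r p1r]]]]].
move=> /(drawing_ray y)[p2 [a2 [M2 [[p2I H2e H2v H2d] p2y a2M p2M [a2r p2r]]]]].
move=> xS yS cover; apply/planarP.
have fst_le (z : R * R) M : `|z| <= M -> - M <= z.1 <= M.
  by rewrite prod_normE /= ge_max => /andP[h _]; rewrite -ler_norml.
(* the first drawing has abscissas at most M1, the second at least M1 + 3 *)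
pose T := M1 + M2 + 3.
have M1_1 : 1 <= M1.
  by have := p1M x; rewrite p1x => /fst_le /andP[].
have M2_1 : 1 <= M2.
  by have := p2M y; rewrite p2y => /fst_le /andP[].
pose flip (z : R * R) : R * R := (T - z.1, z.2).
have flipI : injective flip.
  move=> [a b] [c d] /= [h ->]; congr (_, _).
  by apply: oppr_inj; apply: (addrI T).
have flip_cont : continuous flip.
  move=> z; apply: (@cvg_pair _ _ _ (nbhs z) (nbhs _) (nbhs _)); last exact: cvg_snd.
  by apply: cvgB; [exact: cvg_cst | exact: cvg_fst].
have sep z1 z2 : `|z1| <= M1 -> `|z2| <= M2 -> z1 <> flip z2.
  move=> /fst_le /andP[_ h1] /fst_le /andP[_ h2] E.
  have : z1.1 = T - z2.1 by rewrite E.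
  by rewrite /T; lra.
pose bridge (t : R) : R * R := (1 + t * (T - 2), 0).
have bridge1 t (z : R * R) : t \in `]0, 1[ -> `|z| <= M1 ->
    (forall s, 1 < s -> z <> (s, 0)) -> bridge t <> z.
  rewrite in_itv /= => /andP[t0 t1] _ h /esym; apply: h.
  by rewrite ltrDl mulr_gt0 // /T; lra.
have bridge2 t (z : R * R) : t \in `]0, 1[ -> `|z| <= M2 ->
    (forall s, 1 < s -> z <> (s, 0)) -> bridge t <> flip z.
  rewrite in_itv /= => /andP[t0 t1] _ h; case: z h => a b h [E Eb].
  have aE : a = 1 + (1 - t) * (T - 2) by apply: (addrI (- T)); move: E; lra.
  apply: (h a); last by rewrite -Eb.
  by rewrite aE ltrDl mulr_gt0 // /T; lra.
pose p v := if v \in S then p1 v else flip (p2 v).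
pose c1 (e : {set V}) := (e \in edges G1) && (e \subset S).
pose c2 (e : {set V}) := (e \in edges G2) && (e \subset ~: S)%SET.
pose arc (e : {set V}) t := if c1 e then a1 e t else if c2 e then flip (a2 e t) else bridge t.
have notbr (e : {set V}) : c1 e -> c2 e -> e \notin edges G.
  move=> /andP[eG1 e1] /andP[_ e2]; apply/negP => _.
  have [u /[dup] /(fintype.subsetP e1) uS /(fintype.subsetP e2)] : exists u, u \in e.
    apply/card_gt0P; have := forall_inP (edges_card2 G1) _ eG1.
    by move=> /eqP ->.
  by rewrite finset.inE uS.
have clsP (e : {set V}) : e \in edges G -> [\/ c1 e, ~~ c1 e /\ c2 e | [/\ ~~ c1 e, ~~ c2 e & e = [set x; y]%SET]].
  move=> eE; case: (boolP (c1 e)) => h1; first by constructor.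
  case: (boolP (c2 e)) => h2; first by constructor 2.
  constructor 3; split => //.
  case: (cover e eE) => [[h3 h4]|[h3 h4]|//].
    by move: h1; rewrite /c1 h3 h4.
  by move: h2; rewrite /c2 h3 h4.
have T20 : T - 2 != 0 by rewrite gt_eqF // /T; lra.
have bc : continuous bridge.
  move=> t; apply: (@cvg_pair _ _ _ (nbhs t) (nbhs _) (nbhs _)); last exact: cvg_cst.
  apply: cvgD; first exact: cvg_cst.
  by apply: cvgMr_tmp; exact: cvg_id.
exists p, arc; split.
- move=> v w; rewrite /p; case: ifPn => vS; case: ifPn => wS.
  + exact: p1I.
  + by move=> /sep; case.
  + by move=> /esym /sep; case.
  + by move=> /flipI /p2I.
- move=> e eE; rewrite /arc; case: (clsP e eE) => [h1|[h1 h2]|[h1 h2 eb]].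
  + rewrite h1; case/andP: h1 => eG1 eS.
    have [ce ie [u [v [ee e0 e1]]]] := H1e e eG1; split => //.
    exists u, v; rewrite /p e0 e1.
    have /(fintype.subsetP eS) -> : u \in e by rewrite ee !finset.inE eqxx.
    by have /(fintype.subsetP eS) -> : v \in e by rewrite ee !finset.inE eqxx orbT.
  + rewrite (negbTE h1) h2; case/andP: h2 => eG2 eS.
    have [ce ie [u [v [ee e0 e1]]]] := H2e e eG2; split => //.
    * by move=> t; apply: (@continuous_comp _ _ _ (a2 e)); [exact: ce | exact: flip_cont].
    * by move=> s t sI tI /flipI; exact: ie.
    exists u, v; rewrite /p e0 e1.
    have : u \in e by rewrite ee !finset.inE eqxx.
    move=> /(fintype.subsetP eS); rewrite finset.inE => /negbTE ->.
    have : v \in e by rewrite ee !finset.inE eqxx orbT.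
    by move=> /(fintype.subsetP eS); rewrite finset.inE => /negbTE ->.
  + rewrite (negbTE h1) (negbTE h2); split => //.
    * by move=> s t _ _ [] /addrI /mulIf; exact.
    exists x, y; split => //.
      by rewrite /p xS p1x /bridge mul0r addr0.
    rewrite /p (negbTE yS) p2y /flip /bridge /= mul1r; congr (_, _); lra.
- move=> e t v eE tI; rewrite /arc /p.
  have tJ := itv_oo_cc tI.
  case: (clsP e eE) => [h1|[h1 h2]|[h1 h2 eb]].
  + rewrite h1; case/andP: h1 => eG1 eS.
    by case: ifPn => vS; [exact: H1v | apply: sep => //; exact: a1M].
  + rewrite (negbTE h1) h2; case/andP: h2 => eG2 eS.
    case: ifPn => vS; last by move=> /flipI; exact: H2v.
    by move=> /esym; apply: sep => //; exact: a2M.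
  + rewrite (negbTE h1) (negbTE h2).
    case: ifPn => vS; first by apply: bridge1 => // s; exact: p1r.
    by apply: bridge2 => // s; exact: p2r.
- move=> e e' s t eE e'E ee sI tI; rewrite /arc.
  have sJ := itv_oo_cc sI; have tJ := itv_oo_cc tI.
  case: (clsP e eE) => [h1|[h1 h2]|[h1 h2 eb]];
  case: (clsP e' e'E) => [k1|[k1 k2]|[k1 k2 eb']];
  rewrite ?h1 ?(negbTE h1) ?h2 ?(negbTE h2) ?k1 ?(negbTE k1) ?k2 ?(negbTE k2).
  + by case/andP: h1 => ? _; case/andP: k1 => ? _; exact: H1d.
  + by case/andP: h1 => ? _; case/andP: k2 => ? _; apply: sep; [exact: a1M | exact: a2M].
  + case/andP: h1 => ? _ /esym; apply: bridge1 => //; first exact: a1M.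
    by move=> r; exact: a1r.
  + by case/andP: h2 => ? _; case/andP: k1 => ? _ /esym; apply: sep; [exact: a1M | exact: a2M].
  + by case/andP: h2 => ? _; case/andP: k2 => ? _ /flipI; exact: H2d.
  + case/andP: h2 => ? _ /esym; apply: bridge2 => //; first exact: a2M.
    by move=> r; exact: a2r.
  + case/andP: k1 => ? _; apply: bridge1 => //; first exact: a1M.
    by move=> r; exact: a1r.
  + case/andP: k2 => ? _; apply: bridge2 => //; first exact: a2M.
    by move=> r; exact: a2r.
  + by move: ee; rewrite eb eb' eqxx.
Qed.

Lemma planar_edgeless V (G : sgraph V) : edges G = finset.set0 -> planar R G.
Proof.
move=> G0; apply: (planar_embed (f := @enum_rank V) (G := edgeless _)).
- exact: enum_rank_inj.
- by move=> e; rewrite G0 finset.inE.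
- exact: edgeless_planar.
Qed.

(** The vertices outside the image of [f] are isolated; they are placed to the right
    of the bounded drawing of [H]. *)
Lemma planar_isolated V W (f : W -> V) (G : sgraph V) (H : sgraph W) :
  injective f -> (forall e, e \in edges G -> exists2 e', e' \in edges H & e = (f @: e')%SET) ->
  planar R H -> planar R G.
Proof.
move=> fI sub pH.
have [w0 _|W0] := pickP (@predT W); last first.
  apply: planar_edgeless; apply/setP => e; rewrite finset.inE; apply/negP.
  move=> /sub[e' /(forall_inP (edges_card2 H))].
  have -> : e' = finset.set0 by apply/setP => w; have := W0 w.
  by rewrite cards0.
have [p [arc [M [[pI He Hv Hd] _ aM pM _]]]] := drawing_ray w0 pH.
apply/planarP.
pose far (v : V) : R * R := (M + 1 + (enum_rank v)%:R, 0).
pose q v := if [pick w | f w == v] is Some w then p w else far v.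
have qf w : q (f w) = p w.
  rewrite /q; case: pickP => [w' /eqP/fI-> //|/(_ w)]; by rewrite eqxx.
have fst_le (z : R * R) : `|z| <= M -> z.1 <= M.
  by rewrite prod_normE /= ge_max => /andP[h _]; apply: le_trans h; exact: ler_norm.
have farE z v : `|z| <= M -> z <> far v.
  move=> /fst_le h E; move: h; rewrite E /= -addrA gerDl leNgt.
  by rewrite ltr_wpDr // ler0n.
have qv v : (exists2 w, v = f w & q v = p w) \/ q v = far v.
  rewrite /q; case: pickP => [w /eqP <-|_]; last by right.
  by left; exists w.
pose a (e : {set V}) := arc (f @^-1: e)%SET.
have aE (e : {set W}) : a (f @: e)%SET = arc e.
  rewrite /a; congr arc; apply/setP => w; rewrite finset.inE.
  by rewrite mem_imset.
exists q, a; split.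
- move=> u v; case: (qv u) => [[u' -> ->]|->]; case: (qv v) => [[v' -> ->]|->].
  + by move=> /pI ->.
  + by move=> /farE; case.
  + by move=> /esym/farE; case.
  + move=> /(congr1 fst) /= /addrI /eqP; rewrite eqr_nat => /eqP E.
    by apply: enum_rank_inj; apply: val_inj.
- move=> e /sub[e' e'H ->]; rewrite aE.
  have [ce ie [u [v [ee e0 e1]]]] := He _ e'H; split => //.
  exists (f u), (f v); rewrite !qf; split => //.
  by rewrite ee imsetU1 imset_set1.
- move=> e t v /sub[e' e'H ->]; rewrite aE => tI.
  case: (qv v) => [[w _ ->]|->]; first exact: Hv.
  by apply: farE; apply: aM => //; exact: itv_oo_cc.
- move=> e e' s t /sub[d dH ->] /sub[d' d'H ->] dd; rewrite !aE; apply: Hd => //.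
  by apply: contra dd => /eqP ->.
Qed.
End Drawings.

(** * Labelled graphs with edges inside a vertex subset *)

Section Graphs.
Local Open Scope set_scope.
Local Open Scope nat_scope.

Import mathcomp.boot.fintype mathcomp.boot.finset Pilot.Defs.

Implicit Types (V W : finType).

Lemma imset_pair V W (f : W -> V) a b : f @: [set a; b] = [set f a; f b].
Proof. by rewrite imsetU1 imset_set1. Qed.

Lemma edgeP V (G : sgraph V) e : e \in edges G -> exists x y, x != y /\ e = [set x; y].
Proof.
move=> eE; have /eqP/esym/eqP := forall_inP (edges_card2 G) _ eE.
by rewrite eq_sym => /cards2P[x [y [xy ->]]]; exists x, y.
Qed.

Lemma adj_sym V (G : sgraph V) : symmetric (adj G).
Proof. by move=> x y; rewrite /adj setUC. Qed.

Lemma adjxx V (G : sgraph V) x : adj G x x = false.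
Proof.
apply/negP => /(forall_inP (edges_card2 G)).
by rewrite setUid cards1.
Qed.

Lemma adj_neq V (G : sgraph V) x y : adj G x y -> x != y.
Proof. by apply: contraTneq => ->; rewrite adjxx. Qed.

Lemma connect_adj_sym V (G : sgraph V) : connect_sym (adj G).
Proof. by apply: sym_connect_sym; exact: adj_sym. Qed.

Lemma graph_eq V (G H : sgraph V) : edges G = edges H -> G = H.
Proof. exact: val_inj. Qed.

Fact graph_of_card2 V (E : {set {set V}}) : [forall e in [set e in E | #|e| == 2], #|e| == 2].
Proof. by apply/forall_inP => e; rewrite inE => /andP[]. Qed.

(** Keeps the pairs and drops all other sets, so that no side condition is needed. *)
Definition graph_of V (E : {set {set V}}) := SGraph (graph_of_card2 E).

Lemma graph_ofE V (E : {set {set V}}) e : (e \in edges (graph_of E)) = (e \in E) && (#|e| == 2).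
Proof. by rewrite inE. Qed.

Lemma edge2 V (G : sgraph V) e : e \in edges G -> #|e| == 2.
Proof. by move=> /(forall_inP (edges_card2 G)). Qed.

(** A graph on a subset [S] of [V] is encoded as a graph on [V] with all its edges in
    [S], so that deleting vertices does not change the type. *)
Definition supported V (G : sgraph V) (S : {set V}) := [forall e in edges G, e \subset S].

Lemma supportedP V (G : sgraph V) (S : {set V}) :
  reflect (forall e, e \in edges G -> e \subset S) (supported G S).
Proof. exact: forall_inP. Qed.

Lemma supported_adj V (G : sgraph V) (S : {set V}) x y : supported G S -> adj G x y -> (x \in S) && (y \in S).
Proof. by move=> /supportedP h /h; rewrite subUset !sub1set. Qed.

Definition restrict V (G : sgraph V) (S : {set V}) := graph_of [set e in edges G | e \subset S].

Lemma restrictE V (G : sgraph V) (S : {set V}) e :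
  (e \in edges (restrict G S)) = (e \in edges G) && (e \subset S).
Proof.
rewrite graph_ofE inE; case: (boolP (e \in edges G)) => //= /edge2 ->; by rewrite andbT.
Qed.

Definition graph_union V (G H : sgraph V) := graph_of (edges G :|: edges H).

Lemma graph_unionE V (G H : sgraph V) e :
  (e \in edges (graph_union G H)) = (e \in edges G) || (e \in edges H).
Proof.
rewrite graph_ofE inE; case: (boolP (e \in edges G)) => [/edge2 -> //|_].
by case: (boolP (e \in edges H)) => [/edge2 -> //|_].
Qed.

Definition add_edge V (G : sgraph V) (x y : V) := graph_of ([set x; y] |: edges G).

Lemma add_edgeE V (G : sgraph V) x y e : x != y ->
  (e \in edges (add_edge G x y)) = (e == [set x; y]) || (e \in edges G).
Proof.
move=> xy; rewrite graph_ofE !inE; case: eqP => [->|_] /=; first by rewrite cards2 xy.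
by case: (boolP (e \in edges G)) => [/edge2 -> //|_].
Qed.

Lemma set2_eq V (a b x y : V) : ([set a; b] == [set x; y]) =
  (a == x) && (b == y) || (a == y) && (b == x).
Proof.
apply/eqP/idP => [E|/orP[]/andP[/eqP-> /eqP->] //]; last by rewrite setUC.
have : a \in [set x; y] by rewrite -E !inE eqxx.
have : b \in [set x; y] by rewrite -E !inE eqxx orbT.
have : x \in [set a; b] by rewrite E !inE eqxx.
have : y \in [set a; b] by rewrite E !inE eqxx orbT.
rewrite !inE ![x == _]eq_sym ![y == _]eq_sym.
by case: (a =P x) => [->|]; case: (b =P y) => [->|] //=; case: eqP => //= _; case: eqP.
Qed.

Lemma add_edge_adj V (G : sgraph V) x y a b : x != y ->
  adj (add_edge G x y) a b = [|| (a == x) && (b == y), (a == y) && (b == x) | adj G a b].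
Proof. by move=> xy; rewrite /adj add_edgeE // set2_eq orbA. Qed.

Lemma restrict_adj V (G : sgraph V) (S : {set V}) a b :
  adj (restrict G S) a b = [&& adj G a b, a \in S & b \in S].
Proof. by rewrite /adj restrictE subUset !sub1set. Qed.

Lemma union_adj V (G H : sgraph V) a b : adj (graph_union G H) a b = adj G a b || adj H a b.
Proof. exact: graph_unionE. Qed.

Lemma graph_adj_eq V (G H : sgraph V) : adj G =2 adj H -> G = H.
Proof.
move=> E; apply: graph_eq; apply/setP => e.
by apply/idP/idP => /[dup] /edgeP[x [y [xy ->]]]; rewrite -/(adj _ x y) ?E // -E.
Qed.

Lemma supported_adjP V (G : sgraph V) (S : {set V}) :
  (forall x y, adj G x y -> x \in S) -> supported G S.
Proof.
move=> h; apply/supportedP => e /[dup] eE /edgeP[x [y [xy ee]]].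
rewrite ee subUset !sub1set; rewrite ee in eE; rewrite (h x y) //=.
by apply: (h y x); rewrite adj_sym.
Qed.

Lemma supported_restrict V (G : sgraph V) (S : {set V}) : supported (restrict G S) S.
Proof. by apply: supported_adjP => x y; rewrite restrict_adj => /and3P[]. Qed.

Lemma supported_sub V (G : sgraph V) (S T : {set V}) : S \subset T -> supported G S -> supported G T.
Proof. by move=> ST /supportedP h; apply/supportedP => e /h /subset_trans; apply. Qed.

Lemma supportedT V (G : sgraph V) : supported G [set: V].
Proof. by apply/supportedP => e _; exact: subsetT. Qed.

Lemma connect_stable V (G : sgraph V) (U : {set V}) x y :
  (forall a b, adj G a b -> a \in U -> b \in U) ->
  connect (adj G) x y -> x \in U -> y \in U.
Proof.
move=> h /connectP[p]; elim: p x => [|z p IH] x /=; first by move=> _ ->.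
by move=> /andP[xz pp] yE xU; apply: (IH z) => //; exact: h xU.
Qed.

Lemma connect_homo V W (e : rel V) (e' : rel W) (f : V -> W) x y :
  (forall a b, e a b -> connect e' (f a) (f b)) -> connect e x y ->
  connect e' (f x) (f y).
Proof.
move=> h /connectP[p]; elim: p x => [|z p IH] x /=; first by move=> _ ->.
by move=> /andP[xz pp] yE; apply: connect_trans (h _ _ xz) _; exact: IH.
Qed.

Lemma induced_adj V (G : sgraph V) (S : {set V}) (u v : {x | x \in S}) :
  adj (induced G S) u v = adj G (val u) (val v).
Proof. by rewrite /adj inE imset_pair. Qed.

Lemma connected_inducedP V (G : sgraph V) (S : {set V}) : supported G S ->
  connected_graph (induced G S) <->
  (S != set0 /\ forall x y, x \in S -> y \in S -> connect (adj G) x y).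
Proof.
move=> sG; split.
  move=> /andP[/card_gt0P[u _] /forallP h]; split.
    by apply/set0Pn; exists (val u); exact: valP.
  move=> x y xS yS; have /forallP := h (Sub x xS) => /(_ (Sub y yS)).
  move=> /(@connect_homo _ _ _ (adj G) val); apply => a b.
  by rewrite induced_adj; exact: connect1.
move=> [/set0Pn[x0 x0S] h]; apply/andP; split; first by apply/card_gt0P; exists (Sub x0 x0S).
apply/forallP => u; apply/forallP => v.
have := h _ _ (valP u) (valP v).
move=> /(@connect_homo _ _ _ (adj (induced G S)) (insubd u)).
rewrite !valKd; apply => a b ab; apply: connect1.
have /andP[aS bS] := supported_adj sG ab.
by rewrite induced_adj !insubdK.
Qed.

Lemma induced_eq V (G H : sgraph V) (S : {set V}) :
  (forall x y, x \in S -> y \in S -> adj G x y = adj H x y) -> induced G S = induced H S.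
Proof. by move=> h; apply: graph_adj_eq => u v; rewrite !induced_adj h ?(valP u) ?(valP v). Qed.

Definition class_on V (Q : graph_class) (S : {set V}) : {set sgraph V} :=
  [set G : sgraph V | supported G S && `[< Q _ (induced G S) >]].

Definition push_graph V W (f : W -> V) (H : sgraph W) := graph_of [set f @: (e : {set W}) | e in edges H].

Lemma push_graph_adj V W (f : W -> V) (H : sgraph W) a b : injective f ->
  adj (push_graph f H) (f a) (f b) = adj H a b.
Proof.
move=> fI; rewrite /adj graph_ofE -imset_pair mem_imset ?card_imset //; last exact: imset_inj.
by case: (boolP (_ \in _)) => // /edge2 ->.
Qed.

Lemma push_graph_adjP V W (f : W -> V) (H : sgraph W) x y : injective f -> adj (push_graph f H) x y ->
  exists a b, [/\ x = f a, y = f b & adj H a b].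
Proof.
move=> fI; rewrite {1}/adj graph_ofE => /andP[/imsetP[e eE E] _].
have : x \in f @: e by rewrite -E !inE eqxx.
case/imsetP=> a ae xa.
have : y \in f @: e by rewrite -E !inE eqxx orbT.
case/imsetP=> b be yb; exists a, b; split => //.
rewrite /adj; suff -> : [set a; b] = e by [].
by apply: (imset_inj fI); rewrite -E imset_pair xa yb.
Qed.

(** The enumeration of [S] transports graphs on ['I_#|S|] to graphs supported by [S];
    closure under isomorphism makes this a bijection between the two families. *)
Lemma card_class_on V (Q : graph_class) (S : {set V}) : iso_closed Q ->
  #|class_on Q S| = #|class_graphs Q #|S| |.
Proof.
move=> iso.
pose f : 'I_#|S| -> V := enum_val.
have fI : injective f by exact: enum_val_inj.
have fS i : f i \in S by exact: enum_valP.
have fsurj x : x \in S -> exists i, x = f i.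
  by move=> xS; exists (enum_rank_in xS x); rewrite /f enum_rankK_in.
have supf H : supported (push_graph f H) S.
  by apply: supported_adjP => x y /(push_graph_adjP fI)[a [b [-> _ _]]].
have QP (H : sgraph 'I_#|S|) : Q _ (induced (push_graph f H) S) <-> Q _ H.
  pose g (i : 'I_#|S|) : {x | x \in S} := Sub (f i) (fS i).
  have gI : injective g by move=> i j /(congr1 val) /=; exact: fI.
  have gB : bijective g.
    by apply: inj_card_bij => //; rewrite card_sig card_ord; apply: eq_leq; apply: eq_card => x; rewrite inE.
  have gA a b : adj (induced (push_graph f H) S) (g a) (g b) = adj H a b.
    by rewrite induced_adj /= push_graph_adj.
  split; apply: iso; last by exists g.
  have [h gK hK] := gB; exists h; first by exists g.
  by move=> x y; rewrite -gA !hK.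
have pI : injective (@push_graph V _ f).
  by move=> H K E; apply: graph_adj_eq => a b; rewrite -(push_graph_adj H a b fI) E push_graph_adj.
rewrite -(card_imset _ pI); apply: eq_card => G; rewrite inE.
apply/andP/imsetP => [[sG /asboolP QG]|[H]]; last first.
  by rewrite inE => /asboolP QH ->; split=> //; apply/asboolP/QP.
pose H := graph_of [set e : {set 'I_#|S|} | f @: e \in edges G].
have EG : push_graph f H = G.
  apply: graph_adj_eq => x y.
  have HE a b : adj H a b = adj G (f a) (f b).
    rewrite /adj graph_ofE inE imset_pair -/(adj G _ _).
    by case: (boolP (adj G _ _)) => //= /adj_neq; rewrite (inj_eq fI) cards2 => ->.
  apply/idP/idP => [/(push_graph_adjP fI)[a [b [-> ->]]]|xy]; first by rewrite HE.
  have /andP[xS yS] := supported_adj sG xy.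
  have [a aE] := fsurj x xS; have [b bE] := fsurj y yS.
  by rewrite aE bE push_graph_adj // HE -aE -bE.
exists H => //; rewrite inE; apply/asboolP/QP; by rewrite EG.
Qed.

Lemma componentsP V (G : sgraph V) (S : {set V}) :
  reflect (exists x, S = [set y | connect (adj G) x y]) (S \in components G).
Proof.
apply: (iffP imsetP) => [[x _ ->]|[x ->]]; exists x => //; apply/setP => y; by rewrite !inE.
Qed.

Lemma components_eq V (G : sgraph V) (S : {set V}) x : S \in components G -> x \in S ->
  S = [set y | connect (adj G) x y].
Proof.
move=> /componentsP[z ->]; rewrite inE => zx; apply/setP => y; rewrite !inE.
exact: (same_connect (connect_adj_sym G) zx y).
Qed.

Lemma components_inh V (G : sgraph V) (S : {set V}) : S \in components G -> exists x, x \in S.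
Proof. by move=> /componentsP[x ->]; exists x; rewrite inE connect0. Qed.

Lemma components_closed V (G : sgraph V) (S : {set V}) a b : S \in components G ->
  adj G a b -> (a \in S) = (b \in S).
Proof.
move=> /componentsP[z ->] ab; rewrite !inE.
exact: (same_connect_r (connect_adj_sym G) (connect1 ab) z).
Qed.

Lemma connect_restrict V (G : sgraph V) (U : {set V}) x y :
  (forall a b, adj G a b -> a \in U -> b \in U) -> x \in U ->
  connect (adj (restrict G U)) x y = connect (adj G) x y.
Proof.
move=> h xU; apply/idP/idP.
  by apply: (@connect_homo _ _ _ _ id) => a b; rewrite restrict_adj => /and3P[ab _ _]; exact: connect1.
move=> /connectP[p]; elim: p x xU => [|z p IH] x xU /=; first by move=> _ ->.
move=> /andP[xz pp] yE; have zU := h _ _ xz xU.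
by apply: connect_trans (connect1 _) (IH z zU pp yE); rewrite restrict_adj xz xU zU.
Qed.

Lemma components_restrict V (G : sgraph V) (U S : {set V}) :
  (forall a b, adj G a b -> a \in U -> b \in U) -> S \subset U ->
  (S \in components (restrict G U)) = (S \in components G).
Proof.
move=> h SU; apply/componentsP/componentsP => -[x SE].
  have xU : x \in U by apply: (subsetP SU); rewrite SE inE connect0.
  by exists x; rewrite SE; apply/setP => y; rewrite !inE connect_restrict.
have xU : x \in U by apply: (subsetP SU); rewrite SE inE connect0.
by exists x; rewrite SE; apply/setP => y; rewrite !inE connect_restrict.
Qed.

End Graphs.

(** * Planar graphs and marked components *)

Section PlanarGraphs.
Local Open Scope set_scope.
Local Open Scope nat_scope.
Import mathcomp.boot.fintype mathcomp.boot.finset Pilot.Defs.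
Variable R : realType.
Implicit Types (V W : finType).

Lemma planar_iso : iso_closed (@planar R).
Proof.
move=> V W G H [f [g fK gK] fA].
apply: (planar_embed (f := g)); first exact: can_inj gK.
move=> e /[dup] eE /edgeP[x [y [xy ee]]]; rewrite ee in eE *.
by rewrite imset_pair -/(adj G _ _) -fA !gK.
Qed.

(** Passing to the induced graph on [S] deletes isolated vertices only. *)
Lemma planar_induced V (G : sgraph V) (S : {set V}) : supported G S ->
  planar R (induced G S) <-> planar R G.
Proof.
move=> sG; split.
  apply: (planar_isolated (f := val)); first exact: val_inj.
  move=> e eE; have eS : e \subset S by exact: (supportedP _ _ sG).
  exists (val @^-1: e).
    rewrite inE; suff -> : val @: (val @^-1: e : {set {x | x \in S}}) = e by [].
    apply/setP => x; apply/imsetP/idP => [[u + ->]|xe]; first by rewrite inE.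
    by exists (Sub x (subsetP eS x xe)) => //; rewrite inE.
  apply/setP => x; apply/idP/imsetP => [xe|[u + ->]]; last by rewrite inE.
  by exists (Sub x (subsetP eS x xe)) => //; rewrite inE.
apply: (planar_embed (f := val)); first exact: val_inj.
by move=> e; rewrite inE.
Qed.

Definition planar_on V (S : {set V}) := class_on (@planar R) S.

Lemma planar_onP V (S : {set V}) (G : sgraph V) :
  reflect (supported G S /\ planar R G) (G \in planar_on S).
Proof.
rewrite inE; apply: (iffP andP) => -[sG]; first by move=> /asboolP/(planar_induced sG).
by move=> pG; split => //; apply/asboolP/planar_induced.
Qed.

Lemma planar_subgraph V (G H : sgraph V) : {subset edges H <= edges G} ->
  planar R G -> planar R H.
Proof.
move=> h; apply: (planar_embed (f := id)) => // e /h.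
by rewrite imset_id.
Qed.

Lemma restrict_planar V (G : sgraph V) (S : {set V}) : planar R G -> planar R (restrict G S).
Proof. by apply: planar_subgraph => e; rewrite restrictE => /andP[]. Qed.

(** [planar_join] without its edge; it needs a vertex on each side, and the union is
    one of the two graphs when a side is empty. *)
Lemma union_planar V (G H : sgraph V) (S : {set V}) : supported G S -> supported H (~: S) ->
  planar R G -> planar R H -> planar R (graph_union G H).
Proof.
move=> /supportedP sG /supportedP sH pG pH.
have no (K : sgraph V) e : e \in edges K -> e \subset set0 -> False.
  by move=> /edge2 /eqP; rewrite subset0 => h /eqP E; move: h; rewrite E cards0.
have [x xS|S0] := pickP (mem S); last first.
  apply: planar_subgraph pH => e; rewrite graph_unionE => /orP[|//] eG; exfalso.
  apply: (no G e eG); have -> : set0 = S by apply/setP => x; rewrite inE; have := S0 x.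
  exact: sG.
have [y yS|T0] := pickP (mem (~: S)); last first.
  apply: planar_subgraph pG => e; rewrite graph_unionE => /orP[//|] eG; exfalso.
  apply: (no H e eG); have -> : set0 = ~: S by apply/setP => z; rewrite inE; have := T0 z.
  exact: sH.
apply: (planar_join (S := S) (x := x) (y := y) pG pH xS).
  by move: yS; rewrite /= inE.
move=> e; rewrite graph_unionE => /orP[eG|eH].
  by constructor 1; split => //; exact: sG.
by constructor 2; split => //; exact: sH.
Qed.

(** [planar_join] applied to two copies of [G], with the component of [x] as the
    dividing set. *)
Lemma add_edge_planar V (G : sgraph V) x y : planar R G -> ~~ connect (adj G) x y ->
  planar R (add_edge G x y).
Proof.
move=> pG nxy.
have xy : x != y by apply: contraNneq nxy => ->; exact: connect0.
pose S := [set z | connect (adj G) x z].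
apply: (planar_join (S := S) (x := x) (y := y) pG pG); rewrite ?inE ?connect0 //.
move=> e; rewrite add_edgeE // => /orP[/eqP->|]; first by constructor 3.
move=> /[dup] eG /edgeP[a [b [ab ee]]].
have E : (a \in S) = (b \in S).
  have ab1 : connect (adj G) a b by apply: connect1; rewrite /adj -ee.
  by rewrite !inE (same_connect_r (connect_adj_sym G) ab1).
case: (boolP (a \in S)) => aS.
  by constructor 1; split => //; rewrite ee subUset !sub1set -E aS.
by constructor 2; split => //; rewrite ee subUset !sub1set ![_ \in ~: S]inE -E aS.
Qed.

Section Marking.
Variable A : graph_class.
Hypothesis A_iso : iso_closed A.
Hypothesis A_conn_planar : forall V (G : sgraph V), A G -> connected_graph G /\ planar R G.

(** Only components inside [T] count: for a graph supported by [T], the other vertices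
    are singleton components, which could belong to the class. *)
Definition class_components V (T : {set V}) (G : sgraph V) :=
  [set S in components G | (S \subset T) && `[< A (induced G S) >]].

Lemma restrict_adj_in V (G : sgraph V) (S U : {set V}) x y : S \subset U ->
  x \in S -> y \in S -> adj (restrict G U) x y = adj G x y.
Proof. by move=> /subsetP SU xS yS; rewrite restrict_adj !SU // !andbT. Qed.

Lemma induced_restrict V (G : sgraph V) (S U : {set V}) : S \subset U ->
  induced (restrict G U) S = induced G S.
Proof. by move=> SU; apply: induced_eq => x y xS yS; exact: restrict_adj_in SU _ _. Qed.

Lemma comp_compl_closed V (G : sgraph V) (S T : {set V}) : supported G T -> S \in components G ->
  forall a b, adj G a b -> a \in T :\: S -> b \in T :\: S.
Proof.
move=> sG SC a b ab; rewrite !inE -(components_closed SC ab) => /andP[-> _] /=.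
by have /andP[] := supported_adj sG ab.
Qed.

(** Deleting a component of the class leaves all the others unchanged. *)
Lemma class_components_restrict V (G : sgraph V) (S T : {set V}) : supported G T -> S \in class_components T G ->
  #|class_components T G| = #|class_components (T :\: S) (restrict G (T :\: S))|.+1.
Proof.
move=> sG; rewrite inE => /and3P[SC ST /asboolP AS].
set U := T :\: S.
have -> : class_components T G = S |: class_components U (restrict G U).
  apply/setP => S'; rewrite !inE.
  have [->|neS /=] := eqVneq S' S.
    by rewrite SC ST; apply/asboolP.
  apply/and3P/and3P => [[C1 S1 A1]|[C1 S1 A1]].
    have SU : S' \subset U.
      apply/subsetP => x xS'; rewrite !inE (subsetP S1) // andbT.
      apply: contraNN neS => xS.
      by rewrite (components_eq SC xS) (components_eq C1 xS').
    rewrite components_restrict // ?induced_restrict //.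
    exact: comp_compl_closed.
  rewrite components_restrict // in C1; last exact: comp_compl_closed.
  rewrite induced_restrict // in A1.
  by split => //; apply: subset_trans S1 (subsetDl _ _).
rewrite cardsU1; suff -> : S \notin class_components U (restrict G U) by [].
rewrite !inE !negb_and; apply/orP; right; apply/orP; left.
have [x xS] := components_inh SC.
by apply/subsetPn; exists x; rewrite // !inE xS.
Qed.

Lemma split_component V (S T : {set V}) (G : sgraph V) : supported G T -> S \in components G ->
  graph_union (restrict G S) (restrict G (T :\: S)) = G.
Proof.
move=> sG SC; apply: graph_adj_eq => x y; rewrite union_adj !restrict_adj.
case: (boolP (adj G x y)) => //= xy.
have /andP[xT yT] := supported_adj sG xy.
by rewrite !inE xT yT (components_closed SC xy) !andbT; case: (y \in S).
Qed.

Lemma restrict_union_l V (G H : sgraph V) (S U : {set V}) : supported G S -> supported H U ->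
  [disjoint S & U] -> restrict (graph_union G H) S = G.
Proof.
move=> sG sH dSU; apply: graph_adj_eq => x y; rewrite restrict_adj union_adj.
case: (boolP (adj G x y)) => [/(supported_adj sG)/andP[-> ->] //|_] /=.
apply/negP => /and3P[/(supported_adj sH)/andP[xU _] xS _].
by move: (disjointFr dSU xS); rewrite xU.
Qed.

Lemma graph_unionC V (G H : sgraph V) : graph_union G H = graph_union H G.
Proof. by apply: graph_adj_eq => x y; rewrite !union_adj orbC. Qed.

Lemma restrict_union_r V (G H : sgraph V) (S U : {set V}) : supported G S -> supported H U ->
  [disjoint S & U] -> restrict (graph_union G H) U = H.
Proof. by move=> sG sH d; rewrite graph_unionC (restrict_union_l sH sG) // disjoint_sym. Qed.

Lemma class_on_conn V (S : {set V}) (G : sgraph V) : G \in class_on A S ->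
  [/\ supported G S, planar R G, A (induced G S), S != set0 &
      forall x y, x \in S -> y \in S -> connect (adj G) x y].
Proof.
rewrite inE => /andP[sG /asboolP AG]; have [cG pG] := A_conn_planar AG.
have /(connected_inducedP sG) [S0 cS] := cG.
by split => //; exact: (planar_induced sG).1 pG.
Qed.

Lemma connect_union_l V (G H : sgraph V) x y : connect (adj G) x y ->
  connect (adj (graph_union G H)) x y.
Proof.
apply: (@connect_homo _ _ _ _ id) => a b ab; apply: connect1.
by rewrite union_adj ab.
Qed.

Lemma component_union V (G H : sgraph V) (S U : {set V}) : supported G S -> supported H U ->
  [disjoint S & U] -> S != set0 ->
  (forall x y, x \in S -> y \in S -> connect (adj G) x y) ->
  S \in components (graph_union G H).
Proof.
move=> sG sH dSU /set0Pn[x xS] cS; apply/componentsP; exists x.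
apply/setP => y; rewrite inE; apply/idP/idP => [yS|].
  by apply: connect_union_l; exact: cS.
move=> /connect_stable; apply => // a b; rewrite union_adj => /orP[|].
  by move=> /(supported_adj sG)/andP[].
by move=> /(supported_adj sH)/andP[aU _] aS; move: (disjointFr dSU aS); rewrite aU.
Qed.

(** Double counting of pairs made of a planar graph and one of its components [S] in
    the class.  Such a pair amounts to a graph of the class on [S] and a planar
    graph on [T :\: S], which has one component of the class less. *)
Lemma marking V (T : {set V}) (phi : nat -> nat) :
  \sum_(G in planar_on T) #|class_components T G| * phi #|class_components T G|.-1 =
  \sum_(S : {set V} | S \subset T) #|class_on A S| *
     \sum_(G in planar_on (T :\: S)) phi #|class_components (T :\: S) G|.
Proof.
under eq_bigr => G _ do rewrite -sum_nat_const.
rewrite (exchange_big_dep (fun S : {set V} => S \subset T)) /=; last first.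
  by move=> G S _; rewrite inE => /and3P[].
apply: eq_bigr => S ST; set U := T :\: S.
have dSU : [disjoint S & U].
  by rewrite -setI_eq0; apply/eqP/setP => x; rewrite !inE; case: (x \in S).
have UT : U \subset T by exact: subsetDl.
rewrite -sum_nat_const pair_big /=.
rewrite (reindex_onto (fun p : sgraph V * sgraph V => graph_union p.1 p.2)
   (fun G => (restrict G S, restrict G U))) /=; last first.
  move=> G /andP[/planar_onP[sG pG]]; rewrite inE => /and3P[SC _ _].
  exact: split_component.
have P12 (p : sgraph V * sgraph V) : (graph_union p.1 p.2 \in planar_on T) && (S \in class_components T (graph_union p.1 p.2)) &&
   ((restrict (graph_union p.1 p.2) S, restrict (graph_union p.1 p.2) U) == p) =
   (p.1 \in class_on A S) && (p.2 \in planar_on U).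
  case: p => G1 G2 /=; apply/idP/idP.
    move=> /andP[/andP[/planar_onP[sG pG]]]; rewrite inE => /and3P[SC _ /asboolP AS].
    move=> /eqP[E1 E2]; apply/andP; split.
      rewrite -E1 inE supported_restrict induced_restrict //; exact/asboolP.
    by apply/planar_onP; rewrite -E2; split; [exact: supported_restrict | exact: restrict_planar].
  move=> /andP[/[dup] G1A /class_on_conn[s1 p1 A1 S0 cS] /planar_onP[s2 p2]].
  rewrite (restrict_union_l s1 s2) // (restrict_union_r s1 s2) // eqxx andbT.
  apply/andP; split.
    apply/planar_onP; split.
      apply: supported_adjP => x y; rewrite union_adj => /orP[|].
        by move=> /(supported_adj s1)/andP[xS _]; exact: (subsetP ST).
      by move=> /(supported_adj s2)/andP[xS _]; exact: (subsetP UT).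
    apply: (union_planar (S := S)) => //; apply: supported_sub s2.
    by apply/subsetP => x; rewrite !inE => /andP[].
  rewrite inE ST /= (component_union s1 s2) //=; apply/asboolP.
  rewrite -(@induced_restrict _ _ S S) // (restrict_union_l s1 s2) //.
apply: eq_big => // -[G1 G2]; rewrite P12 => /= /[dup] h /andP[_ G2U].
move: (P12 (G1, G2)); rewrite /= h => /andP[/andP[/planar_onP[sG pG] SA] /eqP[_ E2]].
by rewrite (class_components_restrict sG SA) /= -/U E2.
Qed.

(** Sum over the planar graphs on [t] vertices of the falling factorial of order [k]
    of the number of components in [A]; see [moment_countE]. *)
Fixpoint moment_count (k t : nat) : nat :=
  if k is k'.+1 then \sum_(s < t.+1) 'C(t, s) * #|class_graphs A s| * moment_count k' (t - s)
  else #|class_graphs (@planar R) t|.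

Lemma sum_subsets V (T : {set V}) (F : nat -> nat) :
  \sum_(S : {set V} | S \subset T) F #|S| = \sum_(s < #|T|.+1) 'C(#|T|, s) * F s.
Proof.
rewrite (partition_big (fun S : {set V} => inord #|S| : 'I_#|T|.+1) xpredT) //=.
apply: eq_bigr => s _.
rewrite -cards_draws -sum_nat_const; apply: eq_big => [S|S /andP[ST /eqP <-]].
  rewrite inE; case: (boolP (S \subset T)) => //= ST.
  by rewrite -val_eqE /= inordK // ltnS subset_leq_card.
by rewrite inordK // ltnS subset_leq_card.
Qed.

(** [marking] with the falling factorial for [phi], since
    [n ^_ k.+1 = n * n.-1 ^_ k]. *)
Lemma moment_countE V k (T : {set V}) :
  \sum_(G in planar_on T) #|class_components T G| ^_ k = moment_count k #|T|.
Proof.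
elim: k T => [|k IH] T /=.
  by rewrite sum1_card (card_class_on _ planar_iso).
under eq_bigr => G _ do rewrite ffactnS.
rewrite (marking T (fun n => n ^_ k)).
under [RHS]eq_bigr do rewrite -mulnA.
rewrite -[RHS](sum_subsets T (fun s => #|class_graphs A s| * moment_count k (#|T| - s))).
apply: eq_bigr => S ST; rewrite IH card_class_on //.
by rewrite cardsD (setIidPr ST).
Qed.

End Marking.
End PlanarGraphs.

(** * Leaves of planar graphs *)

Section Leaves.
Local Open Scope set_scope.
Local Open Scope nat_scope.
Import mathcomp.boot.fintype mathcomp.boot.finset Pilot.Defs.
Variable R : realType.
Implicit Types (V W : finType).
Local Notation planar_on := (@planar_on R _).
Local Notation g n := #|class_graphs (@planar R) n|.

Lemma card_planar_on V (S : {set V}) : #|planar_on S| = g #|S|.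
Proof. exact: card_class_on (@planar_iso R). Qed.

Definition leaf_at V (G : sgraph V) v w := [forall u, adj G v u == (u == w)].

Lemma leaf_atP V (G : sgraph V) v w : reflect (adj G v =1 pred1 w) (leaf_at G v w).
Proof. by apply: (iffP forallP) => h u; [apply/eqP/h | apply/eqP/h]. Qed.

Definition leaves V (G : sgraph V) := [set v | [exists w, leaf_at G v w]].

Lemma card_leaves V (G : sgraph V) (T : {set V}) : supported G T ->
  #|leaves G| = \sum_(v in T) \sum_(w in T :\ v) leaf_at G v w.
Proof.
move=> sG.
rewrite -sum1_card [LHS](_ : _ = \sum_(v in T) (v \in leaves G)); last first.
  rewrite -big_mkcondr /=; apply: eq_bigl => v.
  rewrite inE; case: (boolP [exists w, leaf_at G v w]) => [/existsP[w /leaf_atP vw]|]; rewrite ?andbF //.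
  by have /andP[->] : (v \in T) && (w \in T) by apply: (supported_adj sG); rewrite vw /= eqxx.
apply: eq_bigr => v vT; rewrite inE.
case: existsP => [[w /[dup] lw /leaf_atP vw]|no].
  have vw1 : adj G v w by rewrite vw /= eqxx.
  have wT : w \in T :\ v.
    by have /andP[_ wT] := supported_adj sG vw1; rewrite !inE wT andbT eq_sym (adj_neq vw1).
  rewrite (bigD1 w) //= lw big1 // => u /andP[_ uw].
  case: leaf_atP => // vu; move: uw; have := vw u; rewrite vu /= eqxx => /esym/eqP ->.
  by rewrite eqxx.
rewrite big1 // => w _; case: (boolP (leaf_at G v w)) => // lw.
by case: no; exists w.
Qed.

(** Removing the edge at a leaf [v] leaves an arbitrary planar graph on [T :\ v]; the
    edge can always be put back, [v] being isolated. *)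
Lemma leaf_bij V (T : {set V}) v w (psi : sgraph V -> nat) : v \in T -> w \in T :\ v ->
  \sum_(G in planar_on T) leaf_at G v w * psi G = \sum_(G in planar_on (T :\ v)) psi (add_edge G v w).
Proof.
move=> vT; rewrite !inE => /andP[wv wT]; have vw : v != w by rewrite eq_sym.
rewrite [LHS](_ : _ = \sum_(G in planar_on T | leaf_at G v w) psi G); last first.
  rewrite big_mkcondr /=; apply: eq_bigr => G _; by case: (leaf_at G v w); rewrite ?mul1n ?mul0n.
rewrite (reindex_onto (fun G => add_edge G v w) (fun G => restrict G (T :\ v))) /=; last first.
  move=> G /andP[/planar_onP[sG pG] /leaf_atP lG]; apply: graph_adj_eq => x y.
  rewrite add_edge_adj // restrict_adj !inE.
  have [->|xv] := eqVneq x v; rewrite ?andbF /=.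
    by rewrite lG /= (negbTE vw) /= orbF.
  have [->|yv] := eqVneq y v; rewrite ?andbF /=.
    by rewrite [adj G x v]adj_sym lG /= andbT orbF.
  rewrite ?andbF /=; case: (boolP (adj G x y)) => //= xy.
  by have /andP[-> ->] := supported_adj sG xy.
apply: eq_bigl => G; apply/idP/idP.
  move=> /andP[/andP[/planar_onP[sG pG] _] /eqP <-].
  by apply/planar_onP; split; [exact: supported_restrict | exact: restrict_planar].
move=> /planar_onP[sG pG].
have iso u : adj G v u = false.
  by apply/negP => /(supported_adj sG)/andP[]; rewrite !inE eqxx.
apply/andP; split; last first.
  apply/eqP/graph_adj_eq => x y; rewrite restrict_adj add_edge_adj // !inE.
  have [->|xv] := eqVneq x v; first by rewrite /= iso andbF.
  have [->|yv] := eqVneq y v; first by rewrite /= !andbF adj_sym iso.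
  rewrite ?andbF /=; case: (boolP (adj G x y)) => //= /(supported_adj sG).
  by rewrite !inE => /andP[/andP[_ ->] /andP[_ ->]].
apply/andP; split.
  apply/planar_onP; split.
    apply: supported_adjP => x y; rewrite add_edge_adj // => /or3P[/andP[/eqP-> _]|/andP[/eqP-> _]|] //.
    by move=> /(supported_adj sG)/andP[]; rewrite !inE => /andP[].
  apply: add_edge_planar => //; apply/negP => vwc.
  have st a b : adj G a b -> a \in [set v] -> b \in [set v].
    by move=> ab /set1P av; move: ab; rewrite av iso.
  by have := connect_stable st vwc (set11 v); rewrite inE (negbTE wv).
apply/leaf_atP => u; rewrite add_edge_adj // eqxx (negbTE vw) iso /= !orbF //.
Qed.

Lemma leaf_sum V (T : {set V}) (psi : sgraph V -> nat) :
  \sum_(G in planar_on T) #|leaves G| * psi G =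
  \sum_(v in T) \sum_(w in T :\ v) \sum_(G in planar_on (T :\ v)) psi (add_edge G v w).
Proof.
transitivity (\sum_(G in planar_on T) \sum_(v in T) \sum_(w in T :\ v) leaf_at G v w * psi G).
  apply: eq_bigr => G /planar_onP[sG _]; rewrite (card_leaves sG) big_distrl /=.
  by apply: eq_bigr => v _; rewrite big_distrl.
rewrite exchange_big /=; apply: eq_bigr => v vT.
rewrite exchange_big /=; apply: eq_bigr => w wT.
exact: leaf_bij.
Qed.

Lemma card_D1 V (T : {set V}) v : v \in T -> #|T :\ v| = #|T|.-1.
Proof. by move=> vT; rewrite (cardsD1 v T) vT. Qed.

(** Each planar graph on [T :\ v] extends to a graph with leaf [v] in [#|T|.-1] ways. *)
Lemma leaves_total V (T : {set V}) :
  \sum_(G in planar_on T) #|leaves G| = #|T| * #|T|.-1 * g #|T|.-1.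
Proof.
under eq_bigr do rewrite -[#|leaves _|]muln1.
rewrite (leaf_sum T (fun=> 1)) -mulnA -sum_nat_const.
apply: eq_bigr => v vT; rewrite -{1}(card_D1 vT) -sum_nat_const.
by apply: eq_bigr => w wT; rewrite sum1_card card_planar_on (card_D1 vT).
Qed.

(** Only the two ends of the new edge can become leaves. *)
Lemma leaves_add_edge V (G : sgraph V) v w : v != w ->
  #|leaves (add_edge G v w)| <= #|leaves G| + 2.
Proof.
move=> vw; have : leaves (add_edge G v w) \subset [set v; w] :|: leaves G.
  apply/subsetP => x; rewrite !inE => /existsP[u /leaf_atP xu].
  have [//|xv] := eqVneq x v; have [//|xw] := eqVneq x w; rewrite /=.
  apply/existsP; exists u; apply/leaf_atP => y.
  by rewrite -xu add_edge_adj // (negbTE xv) (negbTE xw).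
move=> /subset_leq_card /leq_trans; apply.
by apply: leq_trans (leq_card_setU _ _) _; rewrite cards2 vw addnC.
Qed.

(** One factor [#|leaves G|] chooses a leaf to delete, the other loses at most 2. *)
Lemma leaves_square V (T : {set V}) :
  \sum_(G in planar_on T) #|leaves G| ^ 2 <=
  #|T| * #|T|.-1 * (#|T|.-1 * #|T|.-2 * g #|T|.-2 + 2 * g #|T|.-1).
Proof.
under eq_bigr do rewrite expnS expn1.
rewrite (leaf_sum T (fun G => #|leaves G|)) -mulnA -sum_nat_const.
apply: leq_sum => v vT; rewrite -{1}(card_D1 vT) -sum_nat_const.
apply: leq_sum => w; rewrite !inE => /andP[wv wT].
apply: (@leq_trans (\sum_(G in planar_on (T :\ v)) (#|leaves G| + 2))).
  by apply: leq_sum => G _; apply: leaves_add_edge; rewrite eq_sym.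
by rewrite big_split /= leaves_total sum_nat_const card_planar_on (card_D1 vT) [_ * 2]mulnC.
Qed.

Lemma sum_sqr_leq (I : finType) (P : {set I}) (a : I -> nat) :
  (\sum_(i in P) a i) ^ 2 <= #|P| * \sum_(i in P) a i ^ 2.
Proof.
rewrite -(leq_pmul2l (isT : 0 < 2)).
have -> : 2 * (\sum_(i in P) a i) ^ 2 = \sum_(i in P) \sum_(j in P) 2 * (a i * a j).
  rewrite expnS expn1 big_distrlr big_distrr /=.
  by apply: eq_bigr => i _; rewrite big_distrr.
have -> : 2 * (#|P| * \sum_(i in P) a i ^ 2) = \sum_(i in P) \sum_(j in P) (a i ^ 2 + a j ^ 2).
  under [RHS]eq_bigr do rewrite big_split /= sum_nat_const.
  by rewrite big_split /= sum_nat_const -big_distrr /= mul2n addnn.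
by apply: leq_sum => i _; apply: leq_sum => j _; exact: nat_Cauchy.
Qed.

(** The Cauchy-Schwarz inequality between [leaves_total] and [leaves_square]. *)
Lemma leaf_ineq n :
  n.+2 * n.+1 * g n.+1 ^ 2 <= g n.+2 * (n.+1 * n * g n + 2 * g n.+1).
Proof.
have := sum_sqr_leq (planar_on [set: 'I_n.+2]) (fun G => #|leaves G|).
rewrite leaves_total => /leq_trans /(_ (leq_mul (leqnn _) (leaves_square _))).
rewrite card_planar_on cardsT card_ord /= => h.
have p : 0 < n.+2 * n.+1 by [].
rewrite -(leq_pmul2l p); apply: leq_trans (leq_trans h _); last by rewrite mulnCA.
by apply: eq_leq; move: (g n.+1) => x; rewrite -!mulnn; nia.
Qed.
End Leaves.

(** * Connected planar graphs and gluing *)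

Section Gluing.
Local Open Scope set_scope.
Local Open Scope nat_scope.
Import mathcomp.boot.fintype mathcomp.boot.finset Pilot.Defs.
Variable R : realType.
Implicit Types (V W : finType).
Local Notation planar_on := (@planar_on R _).
Local Notation g n := #|class_graphs (@planar R) n|.

Definition conn_planar : graph_class := fun V G => connected_graph G /\ planar R G.

Local Notation c n := #|class_graphs conn_planar n|.

Lemma conn_planar_iso : iso_closed conn_planar.
Proof.
move=> V W G H /[dup] iso [f [h fK hK] fA] [/andP[V0 /forallP cG] pG]; split.
  apply/andP; split.
    by move: V0 => /card_gt0P[v _]; apply/card_gt0P; exists (f v).
  apply/forallP => x; apply/forallP => y.
  rewrite -(hK x) -(hK y); have /forallP/(_ (h y)) := cG (h x).
  by apply: connect_homo => a b ab; apply: connect1; rewrite fA.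
exact: planar_iso iso pG.
Qed.

Definition conn_planar_on V (S : {set V}) := class_on conn_planar S.

Lemma card_conn_planar_on V (S : {set V}) : #|conn_planar_on S| = c #|S|.
Proof. exact: card_class_on conn_planar_iso. Qed.

Lemma conn_planar_onP V (S : {set V}) (G : sgraph V) :
  reflect [/\ supported G S, planar R G, S != set0 &
     forall x y, x \in S -> y \in S -> connect (adj G) x y] (G \in conn_planar_on S).
Proof.
rewrite inE; apply: (iffP andP) => [[sG /asboolP[cG pG]]|[sG pG S0 cG]].
  have [S0 cS] := (connected_inducedP sG).1 cG.
  by split => //; exact: (planar_induced R sG).1 pG.
split => //; apply/asboolP; split.
  exact: (connected_inducedP sG).2.
exact: (planar_induced R sG).2.
Qed.

Lemma conn_le_planar n : c n <= g n.
Proof.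
apply: subset_leq_card; apply/subsetP => G; rewrite !inE => /asboolP[_ pG].
exact/asboolP.
Qed.

Definition star V (G : sgraph V) (z : V) (D : {set V}) :=
  graph_of ([set [set z; x] | x in D] :|: edges G).

Lemma star_adj V (G : sgraph V) (z : V) (D : {set V}) a b : z \notin D ->
  adj (star G z D) a b = [|| (a == z) && (b \in D), (b == z) && (a \in D) | adj G a b].
Proof.
move=> zD; rewrite {1}/adj graph_ofE !inE.
have -> : ([set a; b] \in [set [set z; x] | x in D]) = (a == z) && (b \in D) || (b == z) && (a \in D).
  apply/imsetP/orP => [[x xD /eqP]|[/andP[/eqP-> bD]|/andP[/eqP-> aD]]].
  - by rewrite set2_eq => /orP[/andP[-> /eqP->]|/andP[/eqP-> ->]]; [left|right].
  - by exists b.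
  - by exists a; rewrite // setUC.
rewrite -orbA -/(adj G a b).
case: (boolP (adj G a b)) => [/adj_neq ab|_]; first by rewrite !orbT cards2 ab.
rewrite !orbF; apply/andb_idr => h; rewrite cards2.
suff -> : a != b by [].
by apply: contraTneq h => ->; rewrite orbb; apply/negP => /andP[/eqP->]; rewrite (negbTE zD).
Qed.

(** The edges at [z] are added one at a time; the component of the next vertex of [D]
    is still separate from [z], because it contains no other vertex of [D]. *)
Lemma star_planar V (G : sgraph V) (z : V) (D : {set V}) : planar R G ->
  (forall x, x \in D -> ~~ connect (adj G) z x) ->
  (forall x y, x \in D -> y \in D -> connect (adj G) x y -> x = y) ->
  planar R (star G z D).
Proof.
move=> pG; move: {2}#|D| (erefl #|D|) => n; elim: n D => [|n IH] D Dn Dz Dxy.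
  apply: planar_subgraph pG => e; rewrite graph_ofE inE => /andP[/orP[|//]] /imsetP[x].
  by move/eqP: Dn; rewrite cards_eq0 => /eqP ->; rewrite inE.
have [x xD] : exists x, x \in D by apply/set0Pn; rewrite -card_gt0 Dn.
have zD : z \notin D by apply/negP => /Dz; rewrite connect0.
set D' := D :\ x.
have D'D : {subset D' <= D} by apply/subsetP; exact: subsetDl.
have zD' : z \notin D' by apply: contraNN zD; exact: D'D.
have pD' : planar R (star G z D').
  apply: IH.
  - by move: Dn; rewrite (cardsD1 x) xD => -[].
  - by move=> y /D'D; exact: Dz.
  - by move=> y y' /D'D yD /D'D; exact: Dxy.
have -> : star G z D = add_edge (star G z D') x z.
  have xz : x != z by apply: contraNneq zD => <-.
  apply: graph_adj_eq => a b; rewrite add_edge_adj // !star_adj // !inE.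
  have [->|ax] := eqVneq a x; have [->|bx] := eqVneq b x; rewrite ?xD ?(negbTE xz) /= ?andbT ?andbF ?orbF ?orbT //.
apply: add_edge_planar => //; apply/negP => xz.
have st a b : adj (star G z D') a b -> a \in [set y | connect (adj G) x y] ->
    b \in [set y | connect (adj G) x y].
  rewrite star_adj // !inE => /or3P[/andP[/eqP-> _] xa|/andP[_ /andP[ax aD]] xa|ab xa].
  - by have := Dz x xD; rewrite connect_adj_sym xa.
  - by move: ax; rewrite (Dxy x a xD aD) ?eqxx.
  - by apply: connect_trans xa (connect1 ab).
have := connect_stable st xz; rewrite !inE connect0 => /(_ isT).
by apply/negP; rewrite connect_adj_sym; exact: Dz.
Qed.

Lemma star_restrict V (G : sgraph V) (z : V) (U D : {set V}) : supported G U -> z \notin U ->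
  z \notin D -> restrict (star G z D) U = G.
Proof.
move=> sG zU zD; apply: graph_adj_eq => x y; rewrite restrict_adj star_adj //.
have [->|xz] := eqVneq x z.
  by rewrite (negbTE zU) andbF; apply/esym/negP => /(supported_adj sG)/andP[]; rewrite (negbTE zU).
have [->|yz] := eqVneq y z.
  by rewrite (negbTE zU) !andbF; apply/esym/negP => /(supported_adj sG)/andP[_]; rewrite (negbTE zU).
by case: (boolP (adj G x y)) => //= /(supported_adj sG).
Qed.

Lemma isolated_not_connected V (G : sgraph V) (U : {set V}) z x : supported G U -> z \notin U -> x != z ->
  ~~ connect (adj G) z x.
Proof.
move=> sG zU xz; apply/negP => zx.
have st a b : adj G a b -> a \in [set z] -> b \in [set z].
  by move=> ab /set1P av; have /andP[] := supported_adj sG ab; rewrite av (negbTE zU).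
by have := connect_stable st zx (set11 z); rewrite inE (negbTE xz).
Qed.

(** Join a new vertex to one vertex of each component: the result is connected, and
    deleting the new vertex recovers the graph. *)
Lemma planar_le_conn n : g n <= c n.+1.
Proof.
pose V := 'I_n.+1; pose z : V := ord0; pose U : {set V} := [set: V] :\ z.
have Un : #|U| = n by rewrite card_D1 ?inE // cardsT card_ord.
have <- : #|planar_on U| = g n by rewrite card_planar_on Un.
have <- : #|conn_planar_on [set: V]| = c n.+1 by rewrite card_conn_planar_on cardsT card_ord.
pose D (G : sgraph V) : {set V} := [set x in U | roots (adj G) x].
have zD G : z \notin D G by rewrite !inE eqxx.
have zU : z \notin U by rewrite !inE eqxx.
have stE G : G \in planar_on U -> restrict (star G z (D G)) U = G.
  by move=> /planar_onP[sG _]; exact: star_restrict.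
have inj : {in planar_on U &, injective (fun G => star G z (D G))}.
  by move=> G H GU HU E; rewrite -(stE G GU) E stE.
rewrite -(card_in_imset inj); apply: subset_leq_card; apply/subsetP => _ /imsetP[G /planar_onP[sG pG] ->].
have noz x : x != z -> ~~ connect (adj G) z x by exact: isolated_not_connected sG zU.
have zc x : connect (adj (star G z (D G))) z x.
  have [->|xz] := eqVneq x z; first exact: connect0.
  have rx : connect (adj G) x (fingraph.root (adj G) x) by exact: connect_root.
  have rz : fingraph.root (adj G) x != z.
    by apply: contraTneq rx => ->; rewrite connect_adj_sym noz.
  apply: (@connect_trans _ _ (fingraph.root (adj G) x)).
    apply: connect1; rewrite star_adj // eqxx !inE rz /=.
    by rewrite roots_root ?orbT //; exact: connect_adj_sym.
  rewrite connect_adj_sym; apply: (@connect_homo _ _ (adj G) _ id) rx => a b ab.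
  by apply: connect1; rewrite star_adj // ab !orbT.
apply/conn_planar_onP; split.
- exact: supportedT.
- apply: star_planar => // [x|x y].
    by rewrite !inE => /andP[/andP[xz _] _]; exact: noz.
  rewrite !inE => /andP[_ /eqP rx] /andP[_ /eqP ry].
  by rewrite -(root_connect (connect_adj_sym G)) rx ry => /eqP.
- by apply/set0Pn; exists z; rewrite inE.
- by move=> x y _ _; apply: connect_trans (zc y); rewrite connect_adj_sym.
Qed.

(** Choose disjoint sets [S] and [T] of [n] and [m] vertices, a connected planar graph
    with a chosen vertex on each, and join a new vertex [z] to the two chosen
    vertices.  The result is planar and connected; given [S] it determines the
    choices, and [S] is one of the two components left when [z] is deleted, whence
    the factor 2. *)
Lemma glue_ineq n m : 'C(n + m, n) * (n * c n) * (m * c m) <= 2 * c (n + m).+1.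
Proof.
pose V := 'I_(n + m).+1; pose z : V := ord0; pose U : {set V} := [set: V] :\ z.
have Un : #|U| = n + m by rewrite card_D1 ?inE // cardsT card_ord.
have zU : z \notin U by rewrite !inE eqxx.
have <- : #|conn_planar_on [set: V]| = c (n + m).+1 by rewrite card_conn_planar_on cardsT card_ord.
pose X (S : {set V}) := setX (setX (conn_planar_on S) S) (setX (conn_planar_on (U :\: S)) (U :\: S)).
pose glue (p : (sgraph V * V) * (sgraph V * V)) := star (graph_union p.1.1 p.2.1) z [set p.1.2; p.2.2].
pose J S := [set glue p | p in X S].
pose P := [set S : {set V} | (S \subset U) && (#|S| == n)].
have XP (S : {set V}) p : S \in P -> p \in X S ->
    [/\ p.1.1 \in conn_planar_on S, p.1.2 \in S, p.2.1 \in conn_planar_on (U :\: S), p.2.2 \in U :\: S &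
     [/\ S \subset U, [disjoint S & U :\: S], supported (graph_union p.1.1 p.2.1) U, z \notin [set p.1.2; p.2.2] &
      restrict (glue p) U = graph_union p.1.1 p.2.1]].
  rewrite inE => /andP[SU _]; case: p => [[G1 x] [G2 y]].
  rewrite !in_setX /= => /andP[/andP[h1 xS] /andP[h2 yS]].
  have [sG1 _ _ _] := conn_planar_onP _ _ h1; have [sG2 _ _ _] := conn_planar_onP _ _ h2.
  have sU : supported (graph_union G1 G2) U.
    apply: supported_adjP => a b; rewrite union_adj => /orP[|].
      by move=> /(supported_adj sG1)/andP[aS _]; exact: (subsetP SU).
    by move=> /(supported_adj sG2)/andP[+ _]; apply/subsetP; exact: subsetDl.
  have zD : z \notin [set x; y].
    rewrite !inE negb_or; apply/andP; split; first by apply: contraNneq zU => ->; exact: (subsetP SU).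
    by apply: contraNneq zU => ->; apply: (subsetP (subsetDl U S)).
  split => //; split => //; last exact: star_restrict.
  by rewrite -setI_eq0; apply/eqP/setP => a; rewrite !inE; case: (a \in S).
have gluenb S p b : S \in P -> p \in X S -> adj (glue p) z b = (b \in [set p.1.2; p.2.2]).
  move=> SP pX; have [_ _ _ _ [SU _ sU zD _]] := XP S p SP pX.
  rewrite star_adj // eqxx /= (negbTE zD) andbF /=.
  suff -> : adj (graph_union p.1.1 p.2.1) z b = false by rewrite orbF.
  by apply/negP => /(supported_adj sU)/andP[]; rewrite (negbTE zU).
have inj S : S \in P -> {in X S &, injective glue}.
  move=> SP p q pX qX E.
  have [/conn_planar_onP[p1 _ _ _] p2 /conn_planar_onP[p3 _ _ _] p4 [SU d _ _ pE]] := XP S p SP pX.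
  have [/conn_planar_onP[q1 _ _ _] q2 /conn_planar_onP[q3 _ _ _] q4 [_ _ _ _ qE]] := XP S q SP qX.
  have E2 : graph_union p.1.1 p.2.1 = graph_union q.1.1 q.2.1 by rewrite -pE -qE E.
  have nb b : (b \in [set p.1.2; p.2.2]) = (b \in [set q.1.2; q.2.2]).
    by rewrite -(gluenb S p) // -(gluenb S q) // E.
  have e1 : p.1.2 = q.1.2.
    have := nb p.1.2; rewrite !inE eqxx /= => /esym/orP[/eqP//|/eqP h].
    by move: q4; rewrite -h !inE p2.
  have e2 : p.2.2 = q.2.2.
    have := nb p.2.2; rewrite !inE eqxx orbT => /esym/orP[/eqP h|/eqP//].
    by move: p4; rewrite h !inE q2.
  have e3 : p.1.1 = q.1.1.
    by rewrite -(restrict_union_l p1 p3 d) E2 (restrict_union_l q1 q3 d).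
  have e4 : p.2.1 = q.2.1.
    by rewrite -(restrict_union_r p1 p3 d) E2 (restrict_union_r q1 q3 d).
  case: p q e1 e2 e3 e4 {pX qX E p1 p2 p3 p4 q1 q2 q3 q4 pE qE E2 nb} => [[a b] [e f]] [[a' b'] [e' f']] /=.
  by move=> -> -> -> ->.
have JC S G : S \in P -> G \in J S ->
    [/\ G \in conn_planar_on [set: V], S \in components (restrict G U) & U :\: S \in components (restrict G U)].
  move=> SP /imsetP[p pX ->]; have [/conn_planar_onP[p1 pl1 S0 c1] p2 /conn_planar_onP[p3 pl3 T0 c3] p4 [SU d sU zD pE]] := XP S p SP pX.
  have cS : S \in components (graph_union p.1.1 p.2.1) by apply: component_union p1 p3 d S0 c1.
  have cT : U :\: S \in components (graph_union p.1.1 p.2.1).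
    by rewrite graph_unionC; apply: component_union p3 p1 _ T0 c3; rewrite disjoint_sym.
  rewrite pE; split => //.
  have xz : p.1.2 != z by apply: contraNneq zU => <-; exact: (subsetP SU).
  have yz : p.2.2 != z by apply: contraNneq zU => <-; apply: (subsetP (subsetDl U S)).
  have hom a b : connect (adj (graph_union p.1.1 p.2.1)) a b -> connect (adj (glue p)) a b.
    apply: (@connect_homo _ _ _ _ id) => u v uv; apply: connect1.
    by rewrite star_adj // uv !orbT.
  have zc v : connect (adj (glue p)) z v.
    have [->|vz] := eqVneq v z; first exact: connect0.
    have [vS|vS] := boolP (v \in S).
      apply: (@connect_trans _ _ p.1.2); first by apply: connect1; rewrite (gluenb S p) // !inE eqxx.
      by apply/hom/connect_union_l/c1.
    have vT : v \in U :\: S by rewrite !inE vS vz.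
    apply: (@connect_trans _ _ p.2.2); first by apply: connect1; rewrite (gluenb S p) // !inE eqxx orbT.
    by apply/hom; rewrite graph_unionC; apply/connect_union_l/c3.
  apply/conn_planar_onP; split.
  - exact: supportedT.
  - have sT : supported p.2.1 (~: S).
      by apply: supported_sub p3; apply/subsetP => a; rewrite !inE => /andP[].
    have nxy : ~~ connect (adj (graph_union p.1.1 p.2.1)) p.1.2 p.2.2.
      apply/negP => h; have := components_eq cS p2; move/setP/(_ p.2.2).
      by rewrite inE h; move: p4; rewrite inE => /andP[/negbTE->].
    apply: star_planar.
    + exact: union_planar p1 sT pl1 pl3.
    + by move=> a; rewrite !inE => /orP[]/eqP->; exact: isolated_not_connected sU zU _.
    + move=> a b; rewrite !inE => /orP[]/eqP-> /orP[]/eqP-> //; first by rewrite (negbTE nxy).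
      by rewrite connect_adj_sym (negbTE nxy).
  - by apply/set0Pn; exists z; rewrite inE.
  - by move=> a b _ _; apply: connect_trans (zc b); rewrite connect_adj_sym.
have cardJ S : S \in P -> #|J S| = (n * c n) * (m * c m).
  move=> SP; rewrite card_in_imset; last exact: inj.
  move: SP; rewrite inE => /andP[SU /eqP Sn].
  have Tm : #|U :\: S| = m by rewrite cardsD (setIidPr SU) Un Sn addKn.
  by rewrite !cardsX !card_conn_planar_on Sn Tm ![_ * c _]mulnC.
(* sum over S of the number of glued graphs, counted graph by graph *)
rewrite -mulnA -{1}Un -cards_draws -sum_nat_const.
rewrite (eq_bigr (fun S => #|J S|)); last by move=> S SP; rewrite cardJ.
under eq_bigr do rewrite -sum1_card.
rewrite (exchange_big_dep (mem (conn_planar_on [set: V]))) /=; last first.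
  by move=> S G SP /(JC S G SP)[].
rewrite mulnC -sum_nat_const; apply: leq_sum => G _.
rewrite sum1_card.
have [S0 /andP[S0P S0J]|none] := pickP (fun S => (S \in P) && (G \in J S)); last first.
  by rewrite eq_card0 // => S; rewrite inE; exact: none.
apply: leq_trans (_ : #|[set S0; U :\: S0]| <= 2); last by rewrite cards2; case: (_ != _).
apply: subset_leq_card; apply/subsetP => S; rewrite [_ \in [pred _ | _]]inE /= => /andP[SP SJ].
have [_ c0 t0] := JC S0 G S0P S0J; have [_ c1 _] := JC S G SP SJ.
have [x xS] := components_inh c1.
have xU : x \in U by move: SP; rewrite inE => /andP[/subsetP-> ].
rewrite !inE; have [xS0|xS0] := boolP (x \in S0).
  by rewrite (components_eq c0 xS0) (components_eq c1 xS) eqxx.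
have xT : x \in U :\: S0 by rewrite inE xS0 xU.
by rewrite [U :\: S0](components_eq t0 xT) (components_eq c1 xS) eqxx orbT.
Qed.
End Gluing.

(** * From supermultiplicativity and slow rise to a ratio limit *)

Section RatioLimit.
Local Open Scope classical_set_scope.
Local Open Scope ring_scope.
Variable R : realType.

(** With [t < t2 < 1] and [w = t / t2], the product [m.+1 * w ^ m] is bounded by the
    geometric series of ratio [w], and [t2 ^ m] tends to 0. *)
Lemma linear_geometric (t : R) (C e : R) : 0 <= t -> t < 1 -> 0 < e ->
  exists M : nat, forall m, (M <= m)%N -> C * m.+1%:R * t ^+ m < e.
Proof.
move=> t0 t1 e0.
pose t2 := (1 + t) / 2.
have t2t : t < t2 by rewrite /t2; lra.
have t21 : t2 < 1 by rewrite /t2; lra.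
have t20 : 0 < t2 by apply: le_lt_trans t2t.
pose w := t / t2.
have w0 : 0 <= w by rewrite divr_ge0 // ltW.
have w1 : w < 1 by rewrite ltr_pdivrMr // mul1r.
have bnd m : m.+1%:R * w ^+ m <= (1 - w)^-1.
  rewrite -[leRHS]mul1r ler_pdivlMr ?subr_gt0 //.
  have : (1 - w) * \sum_(i < m.+1) w ^+ i <= 1.
    by rewrite -[X in X <= _]opprK -mulNr opprB -subrX1 opprB gerBl exprn_ge0.
  apply: le_trans; rewrite mulrC ler_pM2l ?subr_gt0 //.
  rewrite mulrC mulr_natr -[in leLHS](card_ord m.+1) -sumr_const.
  by apply: ler_sum => i _; apply: ler_wiXn2l => //; [exact: ltW | rewrite -ltnS].
pose K := `|C| * (1 - w)^-1 + 1.
have K0 : 0 < K.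
  by rewrite ltr_wpDl // mulr_ge0 // invr_ge0 subr_ge0 ltW.
have /cvgrPdist_lt/(_ (e / K)) : (fun m => t2 ^+ m) @ \oo --> 0.
  by apply: cvg_expr; rewrite ger0_norm // ltW.
case=> [|M _ HM]; first by rewrite divr_gt0.
exists M => m /HM /=; rewrite sub0r normrN ger0_norm ?exprn_ge0 1?ltW //.
rewrite ltr_pdivlMr // => h; apply: le_lt_trans h.
have -> : t ^+ m = t2 ^+ m * w ^+ m.
  by rewrite -exprMn /w mulrCA divff ?mulr1 // gt_eqF.
have t2m : 0 <= t2 ^+ m by rewrite exprn_ge0 // ltW.
rewrite mulrCA ler_wpM2l //.
apply: le_trans (_ : `|C| * (m.+1%:R * w ^+ m) <= _).
  rewrite -mulrA ler_wpM2r // ?ler_norm // mulr_ge0 // exprn_ge0 //.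
rewrite /K; apply: ler_wpDr => //.
exact: ler_wpM2l.
Qed.

Lemma root_gt1 (N : nat) (a : R) : 1 < a -> exists2 b, 1 < b & b ^+ N < a.
Proof.
elim: N a => [|N IH] a a1; first by exists 2; rewrite ?ltr1n // expr0.
pose a' := (1 + a) / 2.
have a'1 : 1 < a' by rewrite /a'; lra.
have a'a : a' < a by rewrite /a'; lra.
have a'0 : 0 < a' by apply: lt_trans a'1.
have [b0 b01 hb0] := IH a' a'1.
exists (Num.min b0 (a / a')).
  by rewrite lt_min b01 /= ltr_pdivlMr // mul1r.
have m1 : 1 < Num.min b0 (a / a') by rewrite lt_min b01 /= ltr_pdivlMr // mul1r.
have m0 : 0 < Num.min b0 (a / a') by apply: lt_trans m1.
rewrite exprS; apply: (@lt_le_trans _ _ (Num.min b0 (a / a') * a')).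
  rewrite ltr_pM2l //; apply: le_lt_trans hb0.
  apply: lerXn2r; rewrite ?nnegrE; [exact: ltW | exact: ltW (lt_trans _ b01) | by rewrite ge_min lexx].
by rewrite -ler_pdivlMr // ge_min lexx orbT.
Qed.

Lemma archi_div (d : R) : 0 < d -> exists2 q : nat, (1 < q)%N & 2 / q%:R <= d.
Proof.
move=> d0; exists (Num.bound (2 / d)).+2 => //.
rewrite ler_pdivrMr ?ltr0n // mulrC -ler_pdivrMr //.
apply/ltW; apply: lt_le_trans (archi_boundP _) _; first by rewrite divr_ge0 // ltW.
by rewrite ler_nat; do 2!apply: leqW.
Qed.

(** [m = n %/ q] is the length of a window around [n], a proportion about [1 / q]. *)
Lemma window (q M n : nat) : (1 < q)%N -> (q * M <= n)%N ->
  exists m, [/\ (M <= m)%N, (m * q <= n)%N, (n < q * m.+1)%N & (m + m <= n)%N].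
Proof.
move=> q1 qM; have q0 : (0 < q)%N by apply: ltnW.
have mq : ((n %/ q) * q <= n)%N by exact: leq_trunc_div.
exists (n %/ q)%N; split => //.
- by rewrite leq_divRL // mulnC.
- by rewrite mulnC ltn_ceil.
- by rewrite addnn -muln2; apply: leq_trans mq; rewrite leq_mul2l q1 orbT.
Qed.

Lemma window_step (q i m n : nat) : (0 < q)%N -> (i <= m)%N -> (m * q <= n)%N ->
  (2 * i)%:R <= (2 / q%:R) * n%:R :> R.
Proof.
move=> q0 im mqn.
rewrite -mulrA [_ * n%:R]mulrC natrM ler_pM2l // ler_pdivlMr ?ltr0n //.
by rewrite -natrM ler_nat; apply: leq_trans mqn; rewrite leq_pmul2r.
Qed.

Section Ratio.
Variables f u : nat -> R.
(** [f] stands for planar graphs and [u k.+1] for connected planar graphs rooted at a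
    vertex, on [k] vertices, both divided by the factorial. *)
Hypothesis f0 : forall n, 0 < f n.
Hypothesis u0 : forall k, (2 <= k)%N -> 0 < u k.
Hypothesis uM : forall k l, (2 <= k)%N -> (2 <= l)%N -> u k * u l <= 2 * u (k + l)%N.
Hypothesis fu : forall n, f n <= u n.+2.
Hypothesis uf : forall n, u n.+1 <= n%:R * f n.
Hypothesis step : forall n, n.+1%:R * f n.+1 ^+ 2 <= f n.+2 * (n%:R * f n + 2 * f n.+1).

Let r n := f n / f n.+1.

Let r0 n : 0 < r n. Proof. by rewrite divr_gt0. Qed.

(* [step] divided by f n.+1 * f n.+2 *)
Let s_step n : n.+1%:R * r n.+1 <= n%:R * r n + 2.
Proof.
have := step n; rewrite -(ler_pM2r (_ : 0 < (f n.+1 * f n.+2)^-1)); last by rewrite invr_gt0 mulr_gt0.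
have h1 : f n.+1 != 0 by rewrite gt_eqF.
have h2 : f n.+2 != 0 by rewrite gt_eqF.
rewrite /r; congr (_ <= _).
  by field; rewrite h1 h2.
by field; rewrite h1 h2.
Qed.

Let s_steps n k : (n + k)%:R * r (n + k) <= n%:R * r n + (2 * k)%:R.
Proof.
elim: k => [|k IH]; first by rewrite addn0 muln0 addr0.
rewrite addnS; apply: le_trans (s_step _) _.
by rewrite mulnS natrD; move: IH; lra.
Qed.

Let prod_r n k : f n = f (n + k)%N * \prod_(i < k) r (n + i).
Proof.
elim: k => [|k IH]; first by rewrite addn0 big_ord0 mulr1.
have E : f (n + k)%N = r (n + k) * f (n + k).+1 by rewrite divfK // gt_eqF.
by rewrite IH {1}E big_ord_recr /= addnS; ring.
Qed.

Let prod_ge n k (y : R) : 0 <= y -> (forall i, (i < k)%N -> y <= r (n + i)) ->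
  y ^+ k * f (n + k) <= f n.
Proof.
move=> y0 h; rewrite (prod_r n k) mulrC ler_pM2l // -[in y ^+ k](card_ord k) -prodr_const.
by apply: ler_prod => i _; rewrite y0 h.
Qed.

Let prod_le n k (y : R) : (forall i, (i < k)%N -> r (n + i) <= y) ->
  f n <= y ^+ k * f (n + k).
Proof.
move=> h; rewrite (prod_r n k) mulrC ler_pM2r // -[in y ^+ k](card_ord k) -prodr_const.
by apply: ler_prod => i _; rewrite h // ltW.
Qed.

(* rho is the inverse of the growth rate of u: above it u n * x ^ n stays away
   from 0, below it u n * x ^ n is at most 2 *)
Let E : set R := [set x | 0 < x /\ exists2 K, (2 <= K)%N & 2 < u K * x ^+ K].

Let E_neq0 : E !=set0.
Proof.
exists (2 / u 2 + 1); have h : 0 < 2 / u 2 by rewrite divr_gt0 // u0.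
split; first by rewrite ltr_wpDl // ltW.
exists 2%N => //; have u2 : 0 < u 2 by exact: u0.
rewrite expr2 mulrA; apply: (@lt_le_trans _ _ (u 2 * (2 / u 2 + 1))).
  by rewrite mulrDr mulrCA divff ?gt_eqF // mulr1 mulr1 ltrDl.
by rewrite ler_peMr ?mulr_ge0 ?addr_ge0 ?lerDr // ltW.
Qed.

Let E_lb : lbound E 0. Proof. by move=> x [/ltW]. Qed.

Let E_hasinf : has_inf E. Proof. by split => //; exists 0. Qed.

Let rho := inf E.

Let rho_ge0 : 0 <= rho. Proof. by apply: lb_le_inf. Qed.

Let above x : rho < x -> exists2 c, 0 < c & forall n, (2 <= n)%N -> c <= u n * x ^+ n.
Proof.
move=> /(inf_lt E_neq0)[y [y0 [K K2 hK]] yx].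
have x0 : 0 < x by apply: lt_trans yx.
pose U n := u n * x ^+ n.
have UK : 2 < U K.
  apply: lt_le_trans hK _; rewrite ler_pM2l ?u0 //.
  by apply: lerXn2r; rewrite ?nnegrE ltW.
have U0 n : (2 <= n)%N -> 0 < U n by move=> n2; rewrite mulr_gt0 ?u0 // exprn_gt0.
(* multiplying by u K * x ^ K > 2 beats the factor 2 of supermultiplicativity *)
have US n : (2 <= n)%N -> U n <= U (n + K)%N.
  move=> n2; have : U n * U K <= 2 * U (n + K)%N.
    by rewrite /U mulrACA -exprD mulrA ler_pM2r ?exprn_gt0 //; exact: uM.
  have := U0 n n2; move: UK; nra.
pose c := \big[Num.min/1]_(i < K) U (i + 2)%N.
exists c; first by apply: lt_bigmin => // i _; rewrite U0 // addn2.
suff main n : c <= U (n + 2)%N.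
  by move=> n n2; rewrite -(subnK n2); exact: main.
elim/ltn_ind: n => n IH; have [nK|Kn] := ltnP n K.
  pose F (i : 'I_K) := U (i + 2)%N; rewrite -[U _]/(F (Ordinal nK)).
  exact: bigmin_le_cond.
have h : c <= U (n - K + 2)%N.
  by apply: IH; rewrite ltn_subrL (leq_trans _ K2) // (leq_trans _ Kn) // (leq_trans _ K2).
apply: le_trans h _; have -> : (n + 2 = n - K + 2 + K)%N by rewrite addnAC subnK.
by apply: US; rewrite addn2.
Qed.

Let below x n : 0 < x -> x < rho -> (2 <= n)%N -> u n * x ^+ n <= 2.
Proof.
move=> x0 xr n2; rewrite leNgt; apply/negP => h.
have : E x by split => //; exists n.
by move=> /(ge_inf E_hasinf.2); rewrite leNgt xr.
Qed.

(* If r n > y, slow rise forces r > y' on the window of length m that ends at n,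
   so f (n - m) / f n.+1 >= y' ^ m.+1.  Supermultiplicativity bounds the same
   quotient by about 2 n / u m, hence by 2 n x ^ m / c with x < y'. *)
Let upper y : rho < y -> \forall n \near \oo, r n <= y.
Proof.
move=> ry; have y0 : 0 < y by apply: le_lt_trans ry.
pose y' := (rho + y) / 2; pose x := (rho + y') / 2.
have [h1 h2 h3] : [/\ rho < x, x < y' & y' < y] by rewrite /x /y'; split; lra.
have x0 : 0 < x by apply: le_lt_trans h1.
have y'0 : 0 < y' by apply: lt_trans h2.
have [c c0 hc] := above h1.
have [q q1 q2] : exists2 q : nat, (1 < q)%N & 2 / q%:R <= y - y'.
  by apply: archi_div; rewrite subr_gt0.
have q0 : (0 < q)%N by exact: ltnW.
have [|||M HM] := @linear_geometric (x / y') (2 * q%:R) (c * y').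
- by rewrite divr_ge0 // ltW.
- by rewrite ltr_pdivrMr // mul1r.
- by rewrite mulr_gt0.
exists (q * maxn M 2)%N => // n /= Hn; rewrite leNgt; apply/negP => yr.
have [m [mM mqn nmq m2n]] := window q1 Hn.
have [Mm m2] : (M <= m)%N /\ (2 <= m)%N by move: mM; rewrite geq_max => /andP.
have mn : (m < n)%N.
  by apply: leq_trans m2n; rewrite -addn1 leq_add2l; exact: ltnW.
have n0 : 0 < n%:R :> R by rewrite ltr0n (leq_trans _ mn).
have rlow i : (i < m.+1)%N -> y' <= r (n - m + i).
  move=> im; pose j := (n - m + i)%N; pose k := (m - i)%N.
  have jk : (j + k)%N = n.
    by rewrite /j /k -addnA subnKC ?subnK // ltnW.
  have := s_steps j k; rewrite jk => hs.
  have j0 : 0 < j%:R :> R by rewrite ltr0n /j addn_gt0 subn_gt0 mn.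
  have jn : j%:R <= n%:R :> R by rewrite ler_nat -jk leq_addr.
  have km : (2 * k)%:R <= (2 / q%:R) * n%:R :> R.
    by apply: window_step mqn => //; exact: leq_subr.
  rewrite leNgt -/j; apply/negP => hj.
  have a1 : j%:R * r j < n%:R * y'.
    apply: (@lt_le_trans _ _ (j%:R * y')); first by rewrite ltr_pM2l.
    by rewrite ler_pM2r.
  have a2 : n%:R * y < n%:R * r n by rewrite ltr_pM2l.
  have a3 : 2 / q%:R * n%:R <= (y - y') * n%:R by rewrite ler_pM2r.
  by move: hs km a1 a2 a3; lra.
have := prod_ge (ltW y'0) rlow.
have -> : (n - m + m.+1 = n.+1)%N by rewrite addnS subnK // ltnW.
move=> P1.
have P2 : f (n - m) * u m <= 2 * (n.+1%:R * f n.+1).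
  apply: (@le_trans _ _ (u (n - m).+2 * u m)); first by rewrite ler_pM2r ?u0.
  apply: le_trans (uM _ m2) _ => //.
  rewrite ler_pM2l //; have -> : ((n - m).+2 + m = n.+2)%N by rewrite !addSn subnK // ltnW.
  exact: uf.
have P3 := hc m m2.
have fn := f0 n.+1.
have P4 : y' ^+ m.+1 * u m <= 2 * n.+1%:R.
  rewrite -(ler_pM2r fn); apply: le_trans (_ : f (n - m) * u m <= _); last by rewrite -mulrA.
  by rewrite mulrAC ler_pM2r // u0.
have P5 : c * y' ^+ m.+1 <= 2 * n.+1%:R * x ^+ m.
  apply: (@le_trans _ _ ((y' ^+ m.+1 * u m) * x ^+ m)); last by rewrite ler_pM2r // exprn_gt0.
  by rewrite mulrC -mulrA ler_pM2l // exprn_gt0.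
have P6 : c * y' ^+ m.+1 <= 2 * (q%:R * m.+1%:R) * x ^+ m.
  apply: le_trans P5 _; rewrite ler_pM2r ?exprn_gt0 // ler_pM2l // -natrM ler_nat //.
have := HM m Mm; apply/negP; rewrite -leNgt.
have Z : 0 < y' ^+ m by rewrite exprn_gt0.
rewrite -(ler_pM2r Z) -[X in _ <= X]mulrA -exprMn divfK ?gt_eqF //.
by rewrite -[c * y' * _]mulrA -exprS -[2 * q%:R * _]mulrA.
Qed.

(* If r n < y, slow rise forces r < y' on the window of length m that starts at n,
   so f n / f (n + m) <= y' ^ m.  But f n is at least of order x1 ^- n and
   f (n + m) at most of order x2 ^- (n + m), with x2 < rho < x1 as close as
   desired; as n is about q * m, this bounds y' ^ m below by about
   (x2 ^ (q + 1) / x1 ^ q) ^ m, which is larger. *)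
Let lower y : 0 < y -> y < rho -> \forall n \near \oo, y <= r n.
Proof.
move=> y0 yr; have [y' h1 h2] : exists2 y', y < y' & y' < rho.
  by exists ((y + rho) / 2); lra.
have y'0 : 0 < y' by apply: lt_trans h1.
have rho0 : 0 < rho by apply: lt_trans yr.
have [q q1 q2] : exists2 q : nat, (1 < q)%N & 2 / q%:R <= y' - y.
  by apply: archi_div; rewrite subr_gt0.
have q0 : (0 < q)%N by exact: ltnW.
have [b b1 hb] : exists2 b, 1 < b & b ^+ (2 * q).+1 < rho / y'.
  by apply: root_gt1; rewrite ltr_pdivlMr // mul1r.
have b0 : 0 < b by apply: lt_trans b1.
pose x1 := rho * b; pose x2 := rho / b.
have g1 : rho < x1 by rewrite /x1 ltr_pMr.
have x20 : 0 < x2 by rewrite divr_gt0.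
have g2 : x2 < rho by rewrite ltr_pdivrMr // ltr_pMr.
have [c c0 hc] := above g1.
pose t := b ^+ (2 * q).+1 * (y' / rho).
have t0 : 0 <= t by apply: mulr_ge0; [apply: exprn_ge0 | apply: divr_ge0]; exact: ltW.
have t1 : t < 1.
  by rewrite /t mulrA ltr_pdivrMr // mul1r -ltr_pdivlMr.
have [|M HM] := @linear_geometric t (2 * q%:R * b ^+ (2 * q)) (c * x2) t0 t1.
  by rewrite mulr_gt0.
exists (q * M.+1)%N => // n /= Hn; rewrite leNgt; apply/negP => ry.
have [m [mM mqn nmq m2n]] := window q1 Hn.
have Mm : (M <= m)%N by exact: ltnW.
have n1 : (0 < n)%N.
  by apply: leq_trans m2n; rewrite addn_gt0 (leq_trans _ mM).
have n0 : 0 < n%:R :> R by rewrite ltr0n.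
have rup i : (i < m)%N -> r (n + i) <= y'.
  move=> im; have hs := s_steps n i.
  have j0 : 0 < (n + i)%:R :> R by rewrite ltr0n addn_gt0 n1.
  have jn : n%:R <= (n + i)%:R :> R by rewrite ler_nat leq_addr.
  have km : (2 * i)%:R <= (2 / q%:R) * n%:R :> R.
    by apply: window_step mqn => //; exact: ltnW.
  rewrite leNgt; apply/negP => hj.
  have a1 : n%:R * y' < (n + i)%:R * r (n + i).
    apply: (@le_lt_trans _ _ ((n + i)%:R * y')); first by rewrite ler_pM2r.
    by rewrite ltr_pM2l.
  have a2 : n%:R * r n < n%:R * y by rewrite ltr_pM2l.
  have a3 : 2 / q%:R * n%:R <= (y' - y) * n%:R by rewrite ler_pM2r.
  by move: hs km a1 a2 a3; lra.
have P1 := prod_le rup.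
have P2 : u (n + m).+2 * x2 ^+ (n + m).+2 <= 2 by exact: below.
have P3 : c <= u n.+1 * x1 ^+ n.+1 by exact: hc.
have X1 : 0 < x1 ^+ n.+1 by rewrite exprn_gt0 // mulr_gt0.
have X2 : 0 < x2 ^+ (n + m).+2 by rewrite exprn_gt0.
have Y : 0 < y' ^+ m by rewrite exprn_gt0.
have P4 : c <= n%:R * (y' ^+ m * f (n + m)) * x1 ^+ n.+1.
  apply: le_trans P3 _; rewrite ler_pM2r //; apply: le_trans (uf n) _.
  by rewrite ler_pM2l.
have P5 : f (n + m) * x2 ^+ (n + m).+2 <= 2.
  by apply: le_trans P2; rewrite ler_pM2r.
have P6 : c * x2 ^+ (n + m).+2 <= 2 * (n%:R * y' ^+ m * x1 ^+ n.+1).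
  apply: (@le_trans _ _ (n%:R * (y' ^+ m * f (n + m)) * x1 ^+ n.+1 * x2 ^+ (n + m).+2)).
    by rewrite ler_pM2r.
  rewrite (_ : _ * _ = (n%:R * y' ^+ m * x1 ^+ n.+1) * (f (n + m) * x2 ^+ (n + m).+2)).
    by rewrite mulrC ler_pM2r // !mulr_gt0.
  by ring.
have := HM m Mm; apply/negP; rewrite -leNgt.
have rn0 : rho != 0 by rewrite gt_eqF.
have bn0 : b != 0 by rewrite gt_eqF.
(* P6 divided by a power of x2; here x1 / x2 = b ^ 2 and y' / x2 = y' * b / rho *)
have P7 : c * x2 <= 2 * (n%:R * b ^+ (2 * n.+1) * (y' * b / rho) ^+ m).
  have Z : 0 < x2 ^+ (n.+1 + m) by rewrite exprn_gt0.
  rewrite -(ler_pM2r Z).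
  have -> : c * x2 * x2 ^+ (n.+1 + m) = c * x2 ^+ (n + m).+2.
    by rewrite -mulrA -exprS.
  apply: le_trans P6 _; rewrite le_eqVlt; apply/orP; left; apply/eqP.
  rewrite exprD /x1 /x2 !exprMn !exprVn mul2n -addnn exprD.
  have := expf_neq0 n.+1 rn0; have := expf_neq0 m rn0.
  have := expf_neq0 n.+1 bn0; have := expf_neq0 m bn0.
  move: (rho ^+ n.+1) (rho ^+ m) (b ^+ n.+1) (b ^+ m) (y' ^+ m) => A1 A2 A3 A4 A5 B1 B2 B3 B4.
  field.
  by rewrite B1 B2 B3.
apply: le_trans P7 _.
rewrite -[2 * q%:R * _]mulrA -[2 * (q%:R * _) * _]mulrA -[2 * _ * t ^+ m]mulrA ler_pM2l //.
have bt : t ^+ m = b ^+ (2 * q * m) * (y' * b / rho) ^+ m.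
  by rewrite /t exprSr -mulrA mulrA -[_ * b * _]mulrA exprMn -exprM; congr (_ * _ ^+ _); ring.
rewrite bt.
have T0 : 0 <= (y' * b / rho) ^+ m by apply/exprn_ge0/divr_ge0; [apply: mulr_ge0 |]; exact: ltW.
rewrite [X in _ <= X](_ : _ = (q * m.+1)%:R * b ^+ (2 * (q * m.+1)) * (y' * b / rho) ^+ m); last first.
  have -> : b ^+ (2 * (q * m.+1)) = b ^+ (2 * q) * b ^+ (2 * q * m).
    by rewrite -exprD mulnA mulnS.
  by rewrite natrM; ring.
rewrite ler_wpM2r //; apply: ler_pM => //.
- by rewrite exprn_ge0 // ltW.
- by rewrite ler_nat ltnW.
- by apply: ler_weXn2l; [exact: ltW | rewrite leq_pmul2l].
Qed.

Lemma ratio_cvg : exists2 l : R, 0 <= l & (fun n => f n / f n.+1) @ \oo --> l.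
Proof.
exists rho => //; apply/cvgrPdist_le => e e0.
have up : \forall n \near \oo, r n <= rho + e by apply: upper; rewrite ltrDl.
have low : \forall n \near \oo, rho - e <= r n.
  have [h|h] := ltP 0 (rho - e).
    by apply: lower => //; rewrite gtrBl.
  by near=> n; apply: le_trans h (ltW (r0 n)).
near=> n; rewrite -/(r n) ler_distlC.
by apply/andP; split; near: n.
Unshelve. all: by end_near. Qed.

End Ratio.
End RatioLimit.

(** * Consequences of a ratio limit, and dominated series *)

Section Series.
Local Open Scope classical_set_scope.
Local Open Scope ring_scope.
Variable R : realType.
Local Notation pseries := (@pseries R).

Section RatioRoot.
Variables (f : nat -> R) (l : R).
Hypothesis f0 : forall n, 0 < f n.
Hypothesis fl : (fun n => f n / f n.+1) @ \oo --> l.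

(** [f n * r ^ n] is eventually nondecreasing; the finitely many earlier terms are
    absorbed by the constant. *)
Lemma dominated_shift (r : R) : l < r -> 0 < r ->
  exists2 C, 0 <= C & forall m n, (m <= n)%N -> f (n - m) <= C * r ^+ m * f n.
Proof.
move=> lr r0.
have [N _ HN] : \forall n \near \oo, f n / f n.+1 < r.
  exact: (fl (lt_nbhsl lr)).
pose h n := f n * r ^+ n.
have h0 n : 0 < h n by rewrite mulr_gt0 // exprn_gt0.
have hS n : (N <= n)%N -> h n <= h n.+1.
  move=> /HN /=; rewrite ltr_pdivrMr // => /ltW H.
  by rewrite /h exprS mulrA ler_pM2r ?exprn_gt0 // mulrC.
pose C := 1 + \sum_(i < N.+1) \sum_(j < N.+1) h i / h j.
have q0 (i j : nat) : 0 <= h i / h j by rewrite divr_ge0 // ltW.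
have C1 : 1 <= C.
  by rewrite lerDl; apply: sumr_ge0 => i _; apply: sumr_ge0 => j _.
have main k n : (k <= n)%N -> h k <= C * h n.
  elim: n k => [|n IH] k kn.
    move: kn; rewrite leqn0 => /eqP ->.
    by rewrite ler_peMl // ltW.
  have [->|kn1] := eqVneq k n.+1; first by rewrite ler_peMl // ltW.
  have kn' : (k <= n)%N by lia.
  have [Nn|nN] := leqP N n.
    apply: le_trans (IH k kn') _; rewrite ler_pM2l ?hS //.
    by apply: lt_le_trans C1.
  rewrite -ler_pdivrMr //.
  have kN : (k < N.+1)%N by lia.
  have nN' : (n.+1 < N.+1)%N by lia.
  rewrite /C (bigD1 (Ordinal kN)) //= (bigD1 (Ordinal nN')) //=.
  rewrite addrCA -addrA lerDl addr_ge0 // ?addr_ge0 //.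
    by apply: sumr_ge0 => j _.
  by apply: sumr_ge0 => i _; apply: sumr_ge0 => j _.
exists C; first exact: le_trans C1.
move=> m n mn; have := main (n - m)%N n (leq_subr _ _).
have -> : h n = f n * (r ^+ m * r ^+ (n - m)) by rewrite -exprD subnKC.
rewrite /h.
rewrite (_ : C * _ = C * r ^+ m * f n * r ^+ (n - m)); last by ring.
by rewrite ler_pM2r // exprn_gt0.
Qed.

Lemma shift_ratio_cvg m : (fun n => f (n - m) / f n) @ \oo --> l ^+ m.
Proof.
suff H : (fun n => f n / f (n + m)%N) @ \oo --> l ^+ m.
  rewrite -(cvg_shiftn m).
  by apply: cvg_trans H; apply: near_eq_cvg; near=> n; rewrite /= addnK.
elim: m => [|m IH].
  rewrite (_ : (fun _ => _) = cst 1); first exact: cvg_cst.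
  by apply/funext => n; rewrite addn0 divff // gt_eqF.
rewrite exprS (_ : (fun _ => _) = (fun n => (f (n + m)%N / f (n + m).+1) * (f n / f (n + m)%N))).
  apply: cvgM => //.
  by move: fl; rewrite -(cvg_shiftn m).
apply/funext => n; rewrite addnS.
have h1 : f (n + m) != 0 by rewrite gt_eqF.
have h2 : f (n + m).+1 != 0 by rewrite gt_eqF.
by field; rewrite h1 h2.
Unshelve. all: by end_near. Qed.

(** For [l > 0], Cesaro means of the logarithm of the ratios.  For [l = 0] the roots
    are unbounded, [limn] returns the default value 0, and the inverse of 0 is 0. *)
Lemma ratio_root : 0 <= l -> (limn (fun n => f n `^ (n%:R)^-1))^-1 = l.
Proof.
rewrite le_eqVlt => /predU1P[l0|l0].
  have -> : limn (fun n => f n `^ (n%:R)^-1) = point.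
    apply: dvgP => /cvg_ex[L /cvgrPdist_lt/(_ 1 ltr01) [N1 _ H1]].
    pose B := `|L| + 1.
    have B0 : 0 < B by rewrite ltr_wpDl.
    have fB n : (N1 <= n)%N -> (0 < n)%N -> f n <= B ^+ n.
      move=> /H1 /= h n0.
      have h1 : f n `^ (n%:R)^-1 <= B.
        rewrite /B -lerBlDl; apply: le_trans (ltW h).
        rewrite distrC; apply: le_trans (lerB_dist _ _).
        by rewrite lerD2r ler_norm.
      have -> : f n = (f n `^ (n%:R)^-1) ^+ n.
        rewrite -powR_mulrn ?powR_ge0 // -powRrM mulVf ?powRr1 ?ltW //.
        by rewrite pnatr_eq0 -lt0n.
      by apply: lerXn2r; rewrite ?nnegrE ?powR_ge0 // ltW.
    have [N2 _ H2] : \forall n \near \oo, f n / f n.+1 < (2 * B)^-1.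
      by apply: (fl (lt_nbhsl _)); rewrite -l0 invr_gt0 mulr_gt0.
    pose N := (maxn N1 N2).+1.
    have gr k : (2 * B) ^+ k * f N <= f (N + k)%N.
      elim: k => [|k IH]; first by rewrite expr0 mul1r addn0.
      have := H2 (N + k)%N; rewrite /= ltr_pdivrMr // => /(_ _)/ltW.
      have N2k : (N2 <= N + k)%N by rewrite /N; lia.
      move=> /(_ N2k); rewrite mulrC ler_pdivlMr ?mulr_gt0 // => hk.
      rewrite addnS; apply: le_trans hk; rewrite exprSr mulrAC ler_pM2r ?mulr_gt0 //.
    have fN := f0 N.
    have [|||M HM] := @linear_geometric R (1 / 2) (B ^+ N) (f N).
    - by rewrite divr_ge0.
    - by rewrite mul1r invf_lt1 // ltr1n.
    - by [].
    move: (HM M (leqnn M)); apply/negP; rewrite -leNgt.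
    have P : (2 * B) ^+ M * f N <= B ^+ (N + M).
      apply: le_trans (gr M) (fB _ _ _); last by rewrite /N addSn.
      by rewrite /N addSn; apply: leqW; apply: leq_trans (leq_addr _ _); exact: leq_maxl.
    have BM : 0 < B ^+ M by rewrite exprn_gt0.
    have {}P : 2 ^+ M * f N <= B ^+ N.
      by rewrite -(ler_pM2r BM) -exprD; apply: le_trans P; rewrite exprMn mulrAC.
    have T : 0 < 2 ^+ M :> R by rewrite exprn_gt0.
    rewrite mul1r exprVn ler_pdivlMr // mulrC; apply: le_trans P _.
    by rewrite ler_peMr ?ler1n // exprn_ge0 // ltW.
  by rewrite -l0; exact: invr0.
have : (fun n => f n `^ (n%:R)^-1) @ \oo --> l^-1.
  suff H : (fun n => f n.+1 `^ (n.+1%:R)^-1) @ \oo --> l^-1.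
    by rewrite -(cvg_shiftS (fun n => f n `^ (n%:R)^-1)).
  have lc : (fun n => ln (f n.+1 / f n)) @ \oo --> - ln l.
    rewrite -lnV ?posrE //; apply: continuous_cvg.
      by apply: continuous_ln; rewrite invr_gt0.
    rewrite (_ : (fun _ => _) = (fun n => (f n / f n.+1)^-1)).
      by apply: cvgV => //; rewrite gt_eqF.
    by apply/funext => n; rewrite invf_div.
  have mean := cesaro lc.
  have z : (fun n => (n.+1%:R : R)^-1 * ln (f 0)) @ \oo --> 0.
    rewrite -[X in _ --> X](mul0r (ln (f 0))); apply: cvgMr_tmp.
    exact: cvg_harmonic.
  have lim : (arithmetic_mean (fun n => ln (f n.+1 / f n)) n + n.+1%:R^-1 * ln (f 0)) @[n --> \oo] --> - ln l.
    by rewrite -[- ln l]addr0; exact: cvgD.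
  rewrite (_ : (fun _ => _) = (fun n => expR (arithmetic_mean (fun n => ln (f n.+1 / f n)) n + n.+1%:R^-1 * ln (f 0)))).
    rewrite (_ : l^-1 = expR (- ln l)); last by rewrite expRN lnK ?posrE.
    exact: (cvg_comp _ _ lim (@continuous_expR R _)).
  apply/funext => n; rewrite /powR gt_eqF //; congr expR.
  rewrite /arithmetic_mean /= -mulrDr; congr (_ * _).
  rewrite /series /= big_mkord.
  elim: n => [|n IH]; first by rewrite big_ord1 ln_div ?posrE // subrK.
  by rewrite big_ord_recr /= addrAC -IH ln_div ?posrE // addrC subrK.
by move/cvg_lim => ->; rewrite ?invrK.
Qed.
End RatioRoot.

Lemma cvg_sum_ord (N : nat) (u : nat -> nat -> R) (v : nat -> R) :
  (forall m, u ^~ m @ \oo --> v m) ->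
  (fun n => \sum_(m < N) u n m) @ \oo --> \sum_(m < N) v m.
Proof.
move=> uv; elim: N => [|N IH].
  rewrite big_ord0 (_ : (fun _ => _) = cst 0); first exact: cvg_cst.
  by apply/funext => n; rewrite big_ord0.
rewrite big_ord_recr /=.
rewrite (_ : (fun _ => _) = (fun n => \sum_(m < N) u n m + u n N)).
  by apply: cvgD; [exact: IH | exact: uv].
by apply/funext => n; rewrite big_ord_recr.
Qed.

(** Dominated convergence for sums of growing length. *)
Lemma tannery (u : nat -> nat -> R) (v d : nat -> R) :
  (forall n m, (m <= n)%N -> `|u n m| <= d m) -> cvgn (series d) ->
  (forall m, u ^~ m @ \oo --> v m) ->
  (fun n => \sum_(m < n.+1) u n m) @ \oo --> limn (series v).
Proof.
move=> ud cd uv.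
have vd m : `|v m| <= d m.
  have h : `|u n m| @[n --> \oo] --> `|v m| by apply: cvg_norm; exact: uv.
  have h2 : (fun _ : nat => d m) @ \oo --> d m by exact: cvg_cst.
  apply: (ler_cvg_to h h2).
  by exists m => // n /= mn; exact: ud.
have d0 m : 0 <= d m by apply: le_trans (vd m).
have cv : cvgn (series v).
  apply: normed_cvg.
  exact: (@series_le_cvg R (fun n => `|v n|) d (fun n => normr_ge0 _) d0 vd cd).
apply/cvgrPdist_lt => e e0.
have e8 : 0 < e / 8 by rewrite divr_gt0.
have /cvgrPdist_lt/(_ _ e8)[N1 _ H1] := cd.
have /cvgrPdist_lt/(_ _ e8)[N2 _ H2] := cv.
pose N := maxn N1 N2.
have tail n : (N <= n)%N -> \sum_(N <= m < n) d m <= e / 4.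
  move=> Nn; have := H1 N (leq_maxl _ _); have := H1 n (leq_trans (leq_maxl _ _) Nn).
  rewrite /= => h1 h2; have <- := sub_series_geq d Nn.
  move: h1 h2; rewrite !ltr_distlC; lra.
have fin : \forall n \near \oo, `|\sum_(m < N) (u n m - v m)| < e / 8.
  have : (fun n => \sum_(m < N) (u n m - v m)) @ \oo --> \sum_(m < N) (v m - v m).
    apply: (@cvg_sum_ord N (fun n m => u n m - v m) (fun m => v m - v m)) => m.
    apply: (@cvgB _ _ _ _ _ (u ^~ m) (fun _ => v m)); [exact: uv | exact: cvg_cst].
  under eq_bigr do rewrite subrr.
  rewrite big1 // => /cvgrPdist_lt/(_ _ e8); apply: filterS => n.
  by rewrite sub0r normrN.
near=> n.
have Nn : (N <= n.+1)%N by near: n; exists N => // k /= Nk; exact: leqW.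
have F : `|\sum_(m < N) (u n m - v m)| < e / 8 by near: n.
have L := H2 N (leq_maxr _ _).
rewrite /= in L.
have split (w : nat -> R) : \sum_(m < n.+1) w m = \sum_(m < N) w m + \sum_(N <= m < n.+1) w m.
  by rewrite -!(big_mkord xpredT w) -big_cat_nat.
have T : `|\sum_(N <= m < n.+1) u n m| <= e / 4.
  refine (le_trans (ler_norm_sum _ _ _) (le_trans _ (tail _ Nn))).
  apply: ler_sum_nat => m /andP[_ mn]; exact: ud.
have F2 : series v N = \sum_(m < N) v m by rewrite /series /= big_mkord.
rewrite split.
move: F; rewrite sumrB -F2.
move: T L; rewrite ler_norml !ltr_norml; lra.
Unshelve. all: by end_near. Qed.
End Series.

(** * Factorial moments and their limits *)

Section PoissonLimit.
Local Open Scope classical_set_scope.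
Local Open Scope ring_scope.
Import Pilot.Defs.
Variable R : realType.
Local Notation g n := #|class_graphs (@planar R) n|.
Local Notation c n := #|class_graphs (@conn_planar R) n|.
Local Notation f n := (egf_coef R (@planar R) n).
Local Notation a n := (egf_coef R (@conn_planar R) n).

Lemma planar_count_gt0 n : (0 < g n)%N.
Proof.
apply/card_gt0P; exists (edgeless 'I_n); rewrite finset.inE.
by apply/asboolP/edgeless_planar.
Qed.

Lemma conn_count_gt0 n : (0 < c n.+1)%N.
Proof. exact: leq_trans (planar_count_gt0 n) (planar_le_conn R n). Qed.

Lemma fact_neq0R n : (n`!%:R : R) != 0. Proof. by rewrite pnatr_eq0 -lt0n fact_gt0. Qed.
Lemma fact_gt0R n : 0 < (n`!%:R : R). Proof. by rewrite ltr0n fact_gt0. Qed.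

Lemma conn_egf_rooted n : n.+1%:R * a n.+1 = (c n.+1)%:R / n`!%:R.
Proof.
rewrite /egf_coef factS natrM.
have h := fact_neq0R n; have h2 : (n.+1%:R : R) != 0 by rewrite pnatr_eq0.
by rewrite invfM mulrCA [X in _ * X]mulrA divff // mul1r.
Qed.

(** The combinatorial inequalities, divided by factorials, are the hypotheses of
    [ratio_cvg]. *)
Lemma planar_ratio_cvg : exists2 l : R, 0 <= l & (fun n => f n / f n.+1) @ \oo --> l.
Proof.
pose u (k : nat) : R := k.-1%:R * a k.-1.
apply: (@ratio_cvg R (fun n => f n) u).
- by move=> n; rewrite divr_gt0 ?fact_gt0R // ltr0n planar_count_gt0.
- case=> [|[|k]] // _; rewrite /u /= conn_egf_rooted divr_gt0 ?fact_gt0R // ltr0n.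
  exact: conn_count_gt0.
- case=> [|n] // [|m] // _ _; rewrite /u addSn addnS /= conn_egf_rooted.
  have := glue_ineq R n m; rewrite -(ler_nat R) => h.
  rewrite [X in _ <= X]mulrA ler_pdivlMr ?fact_gt0R //.
  rewrite !natrM in h; apply: le_trans h.
  have /(congr1 (fun k => k%:R : R)) := bin_fact (leq_addr m n).
  rewrite addKn !natrM => <-; rewrite /egf_coef.
  have hn := fact_neq0R n; have hm := fact_neq0R m.
  by rewrite le_eqVlt; apply/orP; left; apply/eqP; field; rewrite hn hm.
- move=> n; rewrite /u /= conn_egf_rooted /egf_coef ler_pM2r ?invr_gt0 ?fact_gt0R //.
  by rewrite ler_nat planar_le_conn.
- move=> n; rewrite /u /= ler_wpM2l // /egf_coef ler_pM2r ?invr_gt0 ?fact_gt0R //.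
  by rewrite ler_nat conn_le_planar.
- move=> n; have := leaf_ineq R n; rewrite -(ler_nat R).
  rewrite !(natrM, natrD, natrX) /egf_coef !factS !natrM.
  have hn := fact_gt0R n; have hn0 := fact_neq0R n.
  have p1 : (n.+1%:R : R) != 0 by rewrite pnatr_eq0.
  have p2 : (n.+2%:R : R) != 0 by rewrite pnatr_eq0.
  have q1 : 0 < (n.+1%:R : R) by rewrite ltr0n.
  have q2 : 0 < (n.+2%:R : R) by rewrite ltr0n.
  pose D : R := (n.+2%:R * n.+1%:R ^+ 2 * n`!%:R ^+ 2)^-1.
  have D0 : 0 < D by rewrite invr_gt0 !mulr_gt0 ?exprn_gt0.
  rewrite -(ler_pM2r D0) /D; clear D D0 q1 q2 hn.
  move: hn0 p1 p2; move: (n.+1%:R : R) (n.+2%:R : R) (n`!%:R : R) => y1 y2 y3 hn0 p1 p2.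
  move: (g n) (g n.+1) (g n.+2) => x y z h.
  apply: le_trans (le_trans h _); rewrite le_eqVlt; apply/orP; left; apply/eqP.
    by field; rewrite hn0 p1 p2.
  by field; rewrite hn0 p1 p2.
Qed.

Lemma planar_rho_ratio : 0 <= planar_rho R /\ (fun n => f n / f n.+1) @ \oo --> planar_rho R.
Proof.
have [l l0 hl] := planar_ratio_cvg.
suff -> : planar_rho R = l by [].
rewrite /planar_rho /planar_growth; apply: (@ratio_root R (fun n => f n)) => //.
by move=> n; rewrite divr_gt0 ?fact_gt0R // ltr0n planar_count_gt0.
Qed.

Section Moments.
Variable A : graph_class.
Hypothesis A_iso : iso_closed A.
Hypothesis A_conn_planar : forall (V : finType) (G : sgraph V),
  A G -> connected_graph G /\ planar R G.
Hypothesis A_radius : ((planar_rho R)%:E < convergence_radius (egf_coef R A))%E.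

Local Notation alpha := (egf_coef R A).
Local Notation rho := (planar_rho R).
Let lambda : R := egf A rho.

(** The factorial moment of order [k] of the number of components in [A] of
    a uniform planar graph on [n] vertices. *)
Definition fact_moment k n : R := (moment_count R A k n)%:R / (g n)%:R.

Lemma fact_moment0 n : fact_moment 0 n = 1.
Proof. by rewrite /fact_moment /= divff // pnatr_eq0 -lt0n planar_count_gt0. Qed.

Lemma fact_momentS k n :
  fact_moment k.+1 n = \sum_(s < n.+1) alpha s * (f (n - s) / f n) * fact_moment k (n - s).
Proof.
rewrite /fact_moment /= natr_sum mulr_suml; apply: eq_bigr => s _.
have sn : (s <= n)%N by rewrite -ltnS.
have gn : (g n)%:R != 0 :> R by rewrite pnatr_eq0 -lt0n planar_count_gt0.
have gs : (g (n - s))%:R != 0 :> R by rewrite pnatr_eq0 -lt0n planar_count_gt0.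
have := bin_fact sn => /(congr1 (fun k => k%:R : R)).
rewrite !natrM /egf_coef => <-.
have h1 := fact_neq0R s; have h2 := fact_neq0R (n - s).
have h3 : 'C(n, s)%:R != 0 :> R by rewrite pnatr_eq0 -lt0n bin_gt0.
by field; rewrite gn gs h1 h2 h3.
Qed.

Lemma fact_moment_ge0 k n : 0 <= fact_moment k n. Proof. by rewrite divr_ge0. Qed.

Lemma egf_coef_ge0 n : 0 <= alpha n. Proof. by rewrite divr_ge0. Qed.

Lemma planar_egf_gt0 n : 0 < f n. Proof. by rewrite divr_gt0 ?fact_gt0R // ltr0n planar_count_gt0. Qed.

Lemma radius_point : exists2 r : R, rho < r & cvgn (pseries alpha r).
Proof.
have [_ [x cx <-]] := ereal_sup_gt A_radius.
rewrite lte_fin => rx; exists ((rho + `|x|) / 2); first lra.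
apply: is_cvg_pseries_inside cx _.
have [r0 _] := planar_rho_ratio.
rewrite ger0_norm; first lra.
by rewrite divr_ge0 // addr_ge0.
Qed.

(** In [fact_momentS] the weights [alpha s * (f (n - s) / f n)] have a sum bounded
    independently of [n], by domination at a point [r > rho]. *)
Lemma fact_moment_bounded : exists2 L : R, 0 <= L & forall k n, fact_moment k n <= L ^+ k.
Proof.
have [rho0 rl] := planar_rho_ratio; have [r rr cr] := radius_point.
have r0 : 0 < r by apply: le_lt_trans rr.
have [C C0 HC] := dominated_shift planar_egf_gt0 rl rr r0.
pose L := C * limn (pseries alpha r).
have psum n : \sum_(s < n) alpha s * r ^+ s <= limn (pseries alpha r).
  rewrite -(big_mkord xpredT (fun s => alpha s * r ^+ s)).
  apply: (nondecreasing_cvgn_le _ cr n).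
  apply: nondecreasing_series => m _ _ /=.
  by rewrite mulr_ge0 ?egf_coef_ge0 // exprn_ge0 // ltW.
have L0 : 0 <= L.
  by rewrite mulr_ge0 //; have := psum 0%N; rewrite big_ord0.
exists L => //; elim=> [|k IH] n; first by rewrite fact_moment0 expr0.
rewrite fact_momentS exprS.
apply: (@le_trans _ _ (\sum_(s < n.+1) (C * (alpha s * r ^+ s)) * L ^+ k)).
  apply: ler_sum => s _; apply: ler_pM.
  - by rewrite mulr_ge0 ?egf_coef_ge0 // divr_ge0 // ltW // planar_egf_gt0.
  - exact: fact_moment_ge0.
  - rewrite [X in _ <= X]mulrCA ler_wpM2l ?egf_coef_ge0 // ler_pdivrMr ?planar_egf_gt0 // HC //.
    by rewrite -ltnS.
  - exact: IH.
rewrite -mulr_suml ler_wpM2r ?exprn_ge0 // -mulr_sumr ler_wpM2l //.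
Qed.

Lemma fact_moment_cvg k : (fun n => fact_moment k n) @ \oo --> lambda ^+ k.
Proof.
have [rho0 rl] := planar_rho_ratio; have [r rr cr] := radius_point.
have r0 : 0 < r by apply: le_lt_trans rr.
have [C C0 HC] := dominated_shift planar_egf_gt0 rl rr r0.
have [L L0 HL] := fact_moment_bounded.
elim: k => [|k IH].
  rewrite expr0 (_ : (fun _ => _) = cst 1); first exact: cvg_cst.
  by apply/funext => n; rewrite fact_moment0.
rewrite (_ : (fun _ => _) = (fun n => \sum_(s < n.+1) alpha s * (f (n - s) / f n) * fact_moment k (n - s))); last first.
  by apply/funext => n; rewrite fact_momentS.
have cl : cvgn (pseries alpha rho).
  by apply: is_cvg_pseries_inside cr _; rewrite !ger0_norm // ltW.
have -> : lambda ^+ k.+1 = limn (series (fun s => alpha s * rho ^+ s * lambda ^+ k)).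
  apply/esym/cvg_lim => //; rewrite exprS.
  rewrite (_ : series _ = (fun n => pseries alpha rho n * lambda ^+ k)).
    by apply: cvgMr_tmp; exact: cl.
  by apply/funext => n; rewrite /pseries /series /= mulr_suml.
apply: (@tannery R (fun n s => alpha s * (f (n - s) / f n) * fact_moment k (n - s)) _
   (fun s => C * L ^+ k * (alpha s * r ^+ s))).
- move=> n s sn; rewrite ger0_norm; last first.
    by rewrite !mulr_ge0 ?egf_coef_ge0 ?fact_moment_ge0 ?invr_ge0 // ltW // planar_egf_gt0.
  rewrite (_ : C * _ * _ = alpha s * (C * r ^+ s) * L ^+ k); last by ring.
  apply: ler_pM.
  + by rewrite mulr_ge0 ?egf_coef_ge0 // divr_ge0 // ltW // planar_egf_gt0.
  + exact: fact_moment_ge0.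
  + by rewrite ler_wpM2l ?egf_coef_ge0 // ler_pdivrMr ?planar_egf_gt0 // HC.
  + exact: HL.
- exact: is_cvg_seriesZ.
- move=> s; apply: cvgM; first by apply: cvgMl_tmp; exact: (shift_ratio_cvg planar_egf_gt0 rl).
  rewrite -(cvg_shiftn s) /=.
  by move: IH; apply: cvg_trans; apply: near_eq_cvg; near=> n; rewrite /= addnK.
Unshelve. all: by end_near. Qed.

Lemma ffactD n j i : n ^_ (j + i) = (n ^_ j * (n - j) ^_ i)%N.
Proof.
elim: j n => [|j IH] n; first by rewrite add0n subn0 mul1n.
case: n => [|n]; first by rewrite addSn !ffact0n.
by rewrite addSn !ffactSS IH subSS mulnA.
Qed.

(** Both sides vanish for [X < j]; otherwise the sum is ['C(X, j)] times the binomial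
    expansion of [(1 - 1) ^ (X - j)].  Summing up to any [n >= X] changes nothing. *)
Lemma factorial_moment_inversion (X j n : nat) : (X <= n)%N ->
  ((X == j)%:R : R) = \sum_(i < n.+1) (-1) ^+ i * (X ^_ (j + i))%:R / (j`!%:R * i`!%:R).
Proof.
move=> Xn; have [Xj|jX] := ltnP X j.
  rewrite ltn_eqF // big1 // => i _.
  by rewrite ffact_small ?mulr0 ?mul0r // (leq_trans Xj) // leq_addr.
transitivity (\sum_(i < n.+1) (X ^_ j)%:R / j`!%:R * ((-1) ^+ i * 'C(X - j, i)%:R) : R).
  rewrite -mulr_sumr.
  have -> : \sum_(i < n.+1) (-1) ^+ i * 'C(X - j, i)%:R = (1 - 1) ^+ (X - j) :> R.
    rewrite exprDn (big_ord_widen n.+1 (fun i => 1 ^+ (X - j - i) * (-1) ^+ i *+ 'C(X - j, i))); last first.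
      by rewrite ltnS (leq_trans (leq_subr _ _)).
    rewrite [RHS]big_mkcond /=; apply: eq_bigr => i _.
    rewrite expr1n mul1r mulr_natr ltnS; case: leqP => // h.
    by rewrite bin_small.
  rewrite subrr expr0n subn_eq0.
  have [->|ne] := eqVneq X j; first by rewrite leqnn ffactnn divff ?fact_neq0R // mulr1.
  have -> : (X <= j)%N = false by apply/negbTE; rewrite -ltnNge ltn_neqAle eq_sym ne.
  by rewrite mulr0.
apply: eq_bigr => i _.
have /(congr1 (fun k => k%:R : R)) := bin_ffact (X - j) i.
rewrite natrM ffactD natrM => <-.
have h1 := fact_neq0R i; have h2 := fact_neq0R j.
by field; rewrite h1 h2.
Qed.

Lemma class_components_le n (G : sgraph 'I_n) T : (#|class_components A T G| <= n)%N.
Proof.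
rewrite -[X in (_ <= X)%N](card_ord n).
have : class_components A T G \subset components G by apply/fintype.subsetP => S; rewrite finset.inE => /and3P[].
move=> /subset_leq_card /leq_trans; apply.
apply: leq_trans (_ : #|[set: 'I_n]%SET| <= _)%N; last by rewrite cardsT.
exact: leq_imset_card.
Qed.

Definition prob_components j n : R :=
  #|[set G in class_graphs (@planar R) n | #|class_components A [set: 'I_n]%SET G| == j]%SET|%:R / (g n)%:R.

Lemma planar_on_setT n : @planar_on R 'I_n [set: 'I_n]%SET = class_graphs (@planar R) n.
Proof.
apply/setP => G; apply/planar_onP/idP => [[_ pG]|].
  by rewrite finset.inE; apply/asboolP.
by rewrite finset.inE => /asboolP pG; split => //; exact: supportedT.
Qed.

Lemma prob_fact_moment j n : prob_components j n =
  \sum_(i < n.+1) (-1) ^+ i * fact_moment (j + i) n / (j`!%:R * i`!%:R).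
Proof.
rewrite /prob_components -sum1_card natr_sum mulr_suml.
transitivity (\sum_(G in class_graphs (@planar R) n)
   (#|class_components A [set: 'I_n]%SET G| == j)%:R / (g n)%:R : R).
  rewrite [LHS](_ : _ = \sum_(G in class_graphs (@planar R) n |
     #|class_components A [set: 'I_n]%SET G| == j) 1 / (g n)%:R); last first.
    by apply: eq_bigl => G; rewrite !finset.inE.
  rewrite big_mkcondr /=; apply: eq_bigr => G _.
  by case: eqP; rewrite // mul0r.
under eq_bigr => G _.
  rewrite (@factorial_moment_inversion _ j n (class_components_le _ _)) mulr_suml; over.
rewrite exchange_big /=; apply: eq_bigr => i _.
have FE : moment_count R A (j + i) n = \sum_(G in class_graphs (@planar R) n)
    #|class_components A [set: 'I_n]%SET G| ^_ (j + i).
  have := moment_countE A_iso A_conn_planar (j + i) [set: 'I_n]%SET.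
  by rewrite cardsT card_ord planar_on_setT.
rewrite /fact_moment FE natr_sum.
rewrite mulr_suml mulr_sumr mulr_suml; apply: eq_bigr => G _.
by ring.
Qed.

(** The terms of [prob_fact_moment] are dominated by [L ^ j / j!] times the exponential
    series at [L]. *)
Lemma prob_cvg j : (fun n => prob_components j n) @ \oo --> lambda ^+ j / j`!%:R * expR (- lambda).
Proof.
have [L L0 HL] := fact_moment_bounded.
rewrite (_ : (fun _ => _) = (fun n => \sum_(i < n.+1) (-1) ^+ i * fact_moment (j + i) n / (j`!%:R * i`!%:R))); last first.
  by apply/funext => n; rewrite prob_fact_moment.
have -> : lambda ^+ j / j`!%:R * expR (- lambda) =
   limn (series (fun i => (-1) ^+ i * lambda ^+ (j + i) / (j`!%:R * i`!%:R))).
  apply/esym/cvg_lim => //.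
  rewrite (_ : series _ = (fun n => lambda ^+ j / j`!%:R * series (exp_coeff (- lambda)) n)).
    by apply: cvgMl_tmp; exact: is_cvg_series_exp_coeff.
  apply/funext => n; rewrite /series /= mulr_sumr; apply: eq_bigr => i _.
  rewrite /exp_coeff /= exprD -[- lambda]mulN1r exprMn.
  have h1 := fact_neq0R i; have h2 := fact_neq0R j.
  by field; rewrite h1 h2.
apply: (@tannery R (fun n i => (-1) ^+ i * fact_moment (j + i) n / (j`!%:R * i`!%:R)) _
  (fun i => L ^+ j / j`!%:R * exp_coeff L i)).
- move=> n i _; rewrite normrM [`|_ * fact_moment _ _|]normrM normrX normrN1 expr1n mul1r.
  rewrite [`|fact_moment _ _|]ger0_norm ?fact_moment_ge0 // normfV ger0_norm ?mulr_ge0 //.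
  rewrite (_ : _ * exp_coeff L i = L ^+ (j + i) / (j`!%:R * i`!%:R)).
    by rewrite ler_pM2r ?invr_gt0 ?mulr_gt0 ?fact_gt0R.
  rewrite /exp_coeff /= exprD.
  have h1 := fact_neq0R i; have h2 := fact_neq0R j.
  by field; rewrite h1 h2.
- apply: is_cvg_seriesZ; exact: is_cvg_series_exp_coeff.
- by move=> i; apply: cvgMr_tmp; apply: cvgMl_tmp; exact: fact_moment_cvg.
Qed.

End Moments.
End PoissonLimit.

(** * Distribution functions *)

Section Laws.
Local Open Scope classical_set_scope.
Local Open Scope ring_scope.

Lemma nat_le_real (R : realType) (x : R) : exists K : nat, forall k, (k%:R <= x) = (k < K)%N.
Proof.
have [x0|x0] := ltP x 0.
  by exists 0%N => k; rewrite ltn0; apply/negbTE; rewrite -ltNge (lt_le_trans x0).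
exists (Num.truncn x).+1 => k; by rewrite ltnS truncn_ge_nat.
Qed.

Lemma card_lt_sum (I : finType) (P : {set I}) (X : I -> nat) K :
  #|[set i in P | (X i < K)%N]%SET| = (\sum_(j < K) #|[set i in P | X i == j]%SET|)%N.
Proof.
under eq_bigr do rewrite -sum1_card big_mkcond /=.
rewrite exchange_big /= -sum1_card big_mkcond /=; apply: eq_bigr => i _.
rewrite finset.inE; under eq_bigr do rewrite finset.inE.
case: (i \in P) => /=; last by rewrite big1.
case: ltnP => h; last first.
  by rewrite big1 // => j _; rewrite gtn_eqF // (leq_trans _ h).
rewrite (bigD1 (Ordinal h)) //= eqxx big1 // => j; rewrite -val_eqE /= eq_sym.
by move=> /negbTE ->.
Qed.

Lemma cdf_components (R : realType) (A : graph_class) n (x : R) (K : nat) :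
  (forall k, (k%:R <= x) = (k < K)%N) ->
  cdf (components_in R A n : {RV (random_planar R n) >-> R}) x = (\sum_(j < K) prob_components R A j n)%:E.
Proof.
move=> HK; rewrite /cdf /distribution /pushforward /=.
rewrite /random_planar /prob_components -mulr_suml -natr_sum -card_lt_sum.
congr ((_%:R / _)%:E); apply: eq_card => G; rewrite !finset.inE; congr (_ && _).
apply/idP/idP => [/set_mem|h]; last apply/mem_set; rewrite /= in_itv /= /components_in.
  rewrite HK; congr (_ < _)%N; apply: eq_card => S; rewrite !finset.inE.
  by rewrite finset.subsetT.
move: h; rewrite HK; congr (_ < _)%N; apply: eq_card => S; rewrite !finset.inE.
by rewrite finset.subsetT.
Qed.

(** For rate 0 the Poisson law is the Dirac mass at 0, and the formula still holds
    because [0 ^ 0 = 1]. *)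
Lemma cdf_poisson (R : realType) (l : R) (x : R) (K : nat) :
  0 <= l ->
  (forall k, (k%:R <= x) = (k < K)%N) ->
  cdf (natR R : {RV (poisson l) >-> R}) x = (\sum_(j < K) (l ^+ j / j`!%:R * expR (- l)))%:E.
Proof.
move=> l0 HK; rewrite /cdf /distribution /pushforward /=.
have -> : natR R @^-1` `]-oo, x] = `I_K.
  by apply/seteqP; split => k /=; rewrite in_itv /= /natR HK.
rewrite /poisson_prob; case: ifPn => lpos.
  rewrite esum_fset //; last by move=> k _; rewrite lee_fin poisson_pmf_ge0.
  rewrite -fsbig_ord -sumEFin; apply: eq_bigr => j _.
  by rewrite /poisson_pmf lpos.
have -> : l = 0 by apply/eqP; rewrite eq_le l0 leNgt lpos.
rewrite diracE oppr0 expR0; congr (_%:E).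
case: K {HK} => [|K]; first by rewrite big_ord0 memNset.
rewrite mem_set // big_ord_recl /= expr0 fact0 divr1 mulr1 big1 ?addr0 // => i _.
by rewrite expr0n /= !mul0r.
Qed.

End Laws.

Local Open Scope classical_set_scope.
Local Open Scope ring_scope.

Theorem theorem7 (R : realType) (A : graph_class)
  (A_iso : iso_closed A)
  (A_conn_planar : forall (V : finType) (G : sgraph V),
     A V G -> connected_graph G /\ planar R G)
  (A_radius : ((planar_rho R)%:E < convergence_radius (egf_coef R A))%E) :
  cvg_in_distribution
    (fun n => components_in R A n : {RV (random_planar R n) >-> R})
    (natR R : {RV (poisson (egf A (planar_rho R))) >-> R}).
Proof.
move=> x _; have [K HK] := nat_le_real x.
have l0 : 0 <= egf A (planar_rho R).
  have h0 : (fun _ : nat => 0 : R) @ \oo --> 0 by exact: cvg_cst.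
  have h1 := fact_moment_cvg A_radius (k := 1); rewrite expr1 in h1.
  apply: (ler_cvg_to h0 h1).
  by apply: nearW => n; exact: fact_moment_ge0.
rewrite (cdf_poisson l0 HK).
rewrite (_ : (fun n => _) = (fun n => (\sum_(j < K) prob_components R A j n)%:E)); last first.
  by apply/funext => n; rewrite (cdf_components _ _ HK).
apply: cvg_EFin; first by apply: nearW.
have H := @cvg_sum_ord R K (fun n j => prob_components R A j n) _ (fun j => prob_cvg A_iso A_conn_planar A_radius (j := j)).
exact: H.
Qed.
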